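(* Let $I$ be a compact interval, let $g\in M(I)$ be a Markov interval map with transition matrix $A_g$ and $E_g\neq\emptyset$, let $\mathcal{G}=\mathcal{G}_{A_g}$ be the graph of $A_g$, let $x\in E_g$, and let $V\subseteq\mathcal{G}^0$ be such that $\widehat a_{i\,\iota(x)}=0$ for all $i\in V$. Let $X=\{z\in I: g^k(z)=e(x)\text{ for some }k\in\mathbb{N}_0\}$ with counting measure $\mu$. Let $\nu_x$ be the representation of $C^*(\mathcal{G},V)$ on $H_x=\ell^2(R_g(x))$ given by $s_{e_{ij}}\mapsto S_{ij}$, $p_i\mapsto P_i$, and let $\pi:C^*(\mathcal{G},V)\to B(L^2(X,\mu))$ be the representation induced by the relative $\mathcal{G}$-branching system on $X$ given by $D_j=I_j\cap X$, $R_{ij}=g_i^{-1}(I_j\cap X)$, $f_{ij}=g_i^{-1}|_{I_j\cap X}:D_j\to R_{ij}$. Then $L^2(X,\mu)=H_x$ (identifying the characteristic function $\chi_{\{y\}}$ with the basis vector $|y\rangle$), and $\pi$ and $\nu_x$ coincide.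
   Context: $\mathbb{N}=\{1,2,\dots\}$, $\mathbb{N}_0=\{0,1,2,\dots\}$. Markov interval maps. Let $\Gamma=\{c_0,c_1^-,c_1^+,\dots,c_{n-1}^-,c_{n-1}^+,c_n\}$ be real numbers with $c_0<c_1^-\le c_1^+<c_2^-\le\dots<c_{n-1}^-\le c_{n-1}^+<c_n$, and put $I_1=[c_0,c_1^-]$, $I_j=[c_{j-1}^+,c_j^-]$ ($1<j<n$), $I_n=[c_{n-1}^+,c_n]$, $E_j=\,]c_j^-,c_j^+[$ ($1\le j\le n-1$, possibly empty), $I=[c_0,c_n]$. A measurable map $g$ is a Markov interval map, $g\in M(I)$, if for such a partition $C=\{I_1,\dots,I_n\}$: (P1) $\mathrm{dom}(g)=\bigcup_j I_j$, $\mathrm{im}(g)=I$, and each branch $g_i:=g|_{I_i}$ is strictly monotone; (P2) for every $i$, $g(I_i)\cap\bigcup_{j}I_j$ is a non-empty union of intervals from $C$. One has $g(\Gamma)\subset\Gamma$ (each branch $g_i$ maps the endpoints of $I_i$ into $\Gamma$). At an endpoint shared by two adjacent $I_i$'s, $g$ may take a different value for each branch; $g^k(z)=w$ means that $w$ is obtained from $z$ by applying $k$ branches successively. The minimal such partition is fixed. Transition matrix: $A_g=(a_{ij})_{i,j=1}^n$, $a_{ij}=1$ if $g(\mathring I_i)\supset\mathring I_j$ and $a_{ij}=0$ otherwise ($\mathring I$ denotes interior). Escape points: $E_g=\bigcup_{k\ge1}g^{-k}\big(\bigcup_{j=1}^{n-1}E_j\big)$. For $x\in E_g$, $\tau(x)$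 is the least natural number with $g^{\tau(x)}(x)\notin\mathrm{dom}(g)$, $e(x)=g^{\tau(x)}(x)$, and $\iota(x)=\hat j$ where $E_j$ is the escape interval containing $e(x)$; here a symbol $\hat j$ is introduced for each $j$ with $E_j\neq\emptyset$. Escape transition matrix: $\widehat A_g=(\widehat a_{uv})$, indexed by $\{1,\dots,n\}\cup\{\hat j:E_j\neq\emptyset\}$, with $\widehat a_{ij}=a_{ij}$ for $i,j\in\{1,\dots,n\}$; $\widehat a_{i\hat k}=1$ if $i\in\{1,\dots,n\}$ and $\mathring I_i\cap g^{-1}(E_k)\neq\emptyset$; and all other entries $0$. Graph: $\mathcal{G}_{A_g}$ has vertices $\{1,\dots,n\}$ and edges $e_{ij}$ (also written $ij$) for each $a_{ij}=1$, with $s(e_{ij})=i$, $r(e_{ij})=j$. Relative graph algebra: for $V\subseteq\mathcal{G}^0$, $C^*(\mathcal{G},V)$ is the universal $C^*$-algebra generated by partial isometries $\{s_e:e\in\mathcal{G}^1\}$ and mutually orthogonal projections $\{p_v:v\in\mathcal{G}^0\}$ subject to $s_e^*s_e=p_{r(e)}$, $s_es_e^*\le p_{s(e)}$ for all edges $e$, and $p_v=\sum_{s(e)=v}s_es_e^*$ for all $v\in V$ with $s^{-1}(v)\neq\emptyset$. Representation $\nu_x$: $R_g(x)=\{y\in I: g^k(y)=g^m(x)\text{ for some }k,m\in\mathbb{N}_0\}$ is the generalized orbit, $H_x=\ell^2(R_g(x))$ with canonical orthonormal basis $\{|y\rangle:y\in R_g(x)\}$; for $a_{ij}=1$, $S_{ij}|y\rangle=\chi_{I_j}(y)\,|g_i^{-1}(y)\rangle$,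 and $P_i|y\rangle=\chi_{I_i}(y)\,|y\rangle$. Representation $\pi$: as $\mu$ is counting measure, the representation induced by the branching system is the one with $\pi(s_{e_{ij}})(\phi)=\chi_{R_{ij}}\cdot(\phi\circ f_{ij}^{-1})$ (zero outside $R_{ij}$) and $\pi(p_j)(\phi)=\chi_{D_j}\phi$ for $\phi\in L^2(X,\mu)$. *)

(* Defs.v *)
From HB Require Import structures.
From mathcomp Require Import all_boot all_order all_algebra.
From mathcomp Require Import all_classical all_reals all_analysis.
From mathcomp Require Import complex ring.

Set Implicit Arguments.
Unset Strict Implicit.
Unset Printing Implicit Defensive.

Import Order.TTheory GRing.Theory Num.Theory.
Import numFieldNormedType.Exports.

Local Open Scope classical_set_scope.
Local Open Scope ring_scope.

(* The n = gaps_nb.+1 intervals are indexed from 0: interval number i is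
   [lft i, rgt i], so that c_0 = lft 0, c_j^- = rgt (j - 1), c_j^+ = lft j and
   c_n = rgt (n - 1).  The map is given by its branches, so that it may take
   two values at an endpoint shared by two adjacent intervals; the values of
   [branch i] outside interval number i are irrelevant. *)
Record markov_map (R : realType) (a b : R) := MarkovMap {
  gaps_nb : nat;
  lft : 'I_gaps_nb.+1 -> R;
  rgt : 'I_gaps_nb.+1 -> R;
  branch : 'I_gaps_nb.+1 -> R -> R;
  lft_first : lft ord0 = a;
  rgt_last : rgt ord_max = b;
  lft_lt_rgt : forall i, lft i < rgt i;
  rgt_le_lft : forall i j : 'I_gaps_nb.+1, i.+1 = j :> nat -> rgt i <= lft j;
  branch_measurable : forall i, measurable_fun `[lft i, rgt i] (branch i);
  branch_monotone : forall i,
    {in `[lft i, rgt i] &, {homo branch i : x y / x < y}} \/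
    {in `[lft i, rgt i] &, {homo branch i : x y /~ x < y}};
  branch_image : \bigcup_i (branch i @` `[lft i, rgt i]) = `[a, b]%classic;
  branch_markov : forall i, exists2 J : set 'I_gaps_nb.+1, J !=set0 &
    (branch i @` `[lft i, rgt i]) `&` \bigcup_j `[lft j, rgt j]%classic
    = \bigcup_(j in J) `[lft j, rgt j]%classic;
  (* g(Gamma) is contained in Gamma *)
  branch_endpoints : forall i,
    (range lft `|` range rgt) (branch i (lft i)) /\
    (range lft `|` range rgt) (branch i (rgt i))
}.

Section MarkovMap.
Context (R : realType) (a b : R).
Implicit Types (g : markov_map a b) (x z w : R).

Definition piece g (i : 'I_(gaps_nb g).+1) : set R := `[lft i, rgt i].

Definition endpoints g : set R := range (@lft R a b g) `|` range (@rgt R a b g).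

Definition mdom g : set R := \bigcup_i piece (g := g) i.

(* E_{k+1} = ]c_{k+1}^-, c_{k+1}^+[, as gaps are also numbered from 0 *)
Definition gap g (k : 'I_(gaps_nb g)) : set R :=
  `](rgt (widen_ord (leqnSn (gaps_nb g)) k)), (lft (lift ord0 k))[.

Definition gaps g : set R := \bigcup_k gap (g := g) k.

(* [iterate g k z w] is g^k(z) = w: w is obtained from z by applying k branches
   successively. *)
Fixpoint iterate g (k : nat) z w : Prop :=
  if k is k'.+1 then
    exists2 i : 'I_(gaps_nb g).+1, piece i z & iterate g k' (branch i z) w
  else z = w.

(* g^{-k}(B) *)
Definition preimk g (k : nat) (B : set R) : set R :=
  [set z | exists2 w, iterate g k z w & B w].

(* [iterate g 1] is the graph of g as a multivalued map, independently of its
   partition; no strictly coarser partition makes it a Markov interval map. *)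
Definition minimal_partition g : Prop :=
  forall g' : markov_map a b,
    (forall z w, iterate g' 1 z w <-> iterate g 1 z w) ->
    endpoints g' `<=` endpoints g -> endpoints g' = endpoints g.

Definition transition_matrix g : 'M[nat]_((gaps_nb g).+1) :=
  \matrix_(i, j)
    nat_of_bool `[< ((piece j)°)%classic `<=` branch i @` ((piece i)°)%classic >].

Definition escape_set g : set R :=
  \bigcup_(k in [set k | (0 < k)%N]) preimk g k (gaps g).

(* [inr k], for a non-empty gap number k, plays the role of the symbol \hat k. *)
Definition escape_index g : Type :=
  ('I_(gaps_nb g).+1 + {k : 'I_(gaps_nb g) | `[< gap k !=set0 >]})%type.

Definition escape_matrix g (u v : escape_index g) : nat :=
  match u, v with
  | inl i, inl j => transition_matrix g i j
  | inl i, inr k =>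
      nat_of_bool `[< (piece i)° `&` preimk g 1 (gap (val k)) !=set0 >]
  | _, _ => 0%N
  end.

(* tau, e and iota; meaningful on [escape_set g] only *)
Definition exits g x (k : nat) : Prop :=
  exists2 w, iterate g k x w & ~ mdom g w.

Definition esc_time g x : nat :=
  xget 0%N [set k | [/\ (0 < k)%N, exits g x k &
    forall m, (0 < m)%N -> exits g x m -> (k <= m)%N]].

Definition esc_point g x : R :=
  xget 0 [set w | iterate g (esc_time g x) x w /\ ~ mdom g w].

Definition esc_symbol g x : escape_index g :=
  xget (inl ord0) [set u | exists2 k, u = inr k & gap (val k) (esc_point g x)].

(* R_g(x) *)
Definition gorbit g x : set R :=
  [set y | `[a, b]%classic y /\
    exists k m w, iterate g k y w /\ iterate g m x w].

(* X *)
Definition backward_orbit g x : set R :=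
  [set z | `[a, b]%classic z /\ exists k, iterate g k z (esc_point g x)].

(* g_i^{-1} *)
Definition branch_inv g (i : 'I_(gaps_nb g).+1) : R -> R :=
  'pinv_(fun=> 0) (piece i) (branch i).

End MarkovMap.

Record graph := Graph {
  vertex : finType;
  edge : finType;
  src : edge -> vertex;
  rng : edge -> vertex
}.

Definition matrix_graph n (A : 'M[nat]_n) : graph :=
  @Graph 'I_n {ij : 'I_n * 'I_n | A ij.1 ij.2 == 1%N}
    (fun e => (val e).1) (fun e => (val e).2).

Definition markov_graph (R : realType) (a b : R) (g : markov_map a b) : graph :=
  matrix_graph (transition_matrix g).

(* A C*-algebra need not have a unit. *)
HB.mixin Record isCStarAlgebra (R : realType) (A : Type)
    & CompleteNormedModule R[i] A := {
  cmul : A -> A -> A;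
  star : A -> A;
  cmulA : associative cmul;
  cmulDl : left_distributive cmul +%R;
  cmulDr : right_distributive cmul +%R;
  cmulZl : forall (c : R[i]) (x y : A), cmul (c *: x) y = c *: cmul x y;
  cmulZr : forall (c : R[i]) (x y : A), cmul x (c *: y) = c *: cmul x y;
  starK : involutive star;
  starD : {morph star : x y / x + y};
  starZ : forall (c : R[i]) (x : A), star (c *: x) = conjc c *: star x;
  starM : forall x y, star (cmul x y) = cmul (star y) (star x);
  cmul_norm : forall x y : A, `|cmul x y| <= `|x| * `|y|;
  star_norm : forall x : A, `|cmul (star x) x| = `|x| ^+ 2
}.

#[short(type="cstarAlgType")]
HB.structure Definition CStarAlgebra (R : realType) :=
  {A of isCStarAlgebra R A & CompleteNormedModule R[i] A}.

Section CStar.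
Context (R : realType).

(* The positive elements are those of the form c^* c. *)
Definition cstar_le (A : cstarAlgType R) (x y : A) : Prop :=
  exists c : A, y - x = cmul (star c) c.

Record star_morphism (A B : cstarAlgType R) (f : A -> B) : Prop := {
  star_morphism_linear : linear f;
  star_morphism_mul : {morph f : x y / cmul x y};
  star_morphism_star : {morph f : x / star x}
}.

Record relative_family (G : graph) (V : {set vertex G}) (A : cstarAlgType R)
    (s : edge G -> A) (p : vertex G -> A) : Prop := {
  family_partial_isometry : forall e,
    cmul (cmul (s e) (star (s e))) (s e) = s e;
  family_projection : forall v, cmul (p v) (p v) = p v /\ star (p v) = p v;
  family_orthogonal : forall v w, v != w -> cmul (p v) (p w) = 0;
  family_rng : forall e, cmul (star (s e)) (s e) = p (rng e);
  family_src : forall e, cstar_le (cmul (s e) (star (s e))) (p (src e));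
  family_sum : forall v, v \in V -> (exists e, src e = v) ->
    p v = \sum_(e | src e == v) cmul (s e) (star (s e))
}.

(* (A, s, p) is C*(G, V) *)
Definition is_relative_graph_algebra (G : graph) (V : {set vertex G})
    (A : cstarAlgType R) (s : edge G -> A) (p : vertex G -> A) : Prop :=
  relative_family V s p /\
  forall (B : cstarAlgType R) (t : edge G -> B) (q : vertex G -> B),
    relative_family V t q ->
    exists! f : A -> B, [/\ star_morphism f,
      forall e, f (s e) = t e & forall v, f (p v) = q v].

End CStar.

(* T with the sigma-algebra of all its subsets *)
Definition discrete (T : Type) : Type := T.
HB.instance Definition _ (T : pointedType) := Pointed.copy (discrete T) T.
HB.instance Definition _ (T : pointedType) :=
  @isMeasurable.Build default_measure_display (discrete T) discrete_measurable
    discrete_measurable0 discrete_measurableC discrete_measurableU.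

Definition counting_measure (R : realType) :
    {measure set (discrete R) -> \bar R} :=
  @counting (discrete R) R.

Section L2.
Context (R : realType).
Local Notation mu := (counting_measure R).
Local Notation abs2 z := (Normc.normc z ^+ 2).

Definition square_integrable (X : set R) (f : R -> R[i]) : Prop :=
  (forall z, ~ X z -> f z = 0) /\
  (\int[mu]_(z in X) (abs2 (f z))%:E < +oo)%E.

Lemma abs2_ge0 (z : R[i]) : 0 <= abs2 z.
Proof. exact: sqr_ge0. Qed.

Lemma abs2D (z w : R[i]) : abs2 (z + w) <= 2 * abs2 z + 2 * abs2 w.
Proof.
case: z w => [p q] [r t] /=; rewrite !sqr_sqrtr ?addr_ge0 ?sqr_ge0// -subr_ge0.
have -> : 2 * (p ^+ 2 + q ^+ 2) + 2 * (r ^+ 2 + t ^+ 2)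
          - ((p + r) ^+ 2 + (q + t) ^+ 2) = (p - r) ^+ 2 + (q - t) ^+ 2 by ring.
by rewrite addr_ge0// sqr_ge0.
Qed.

Lemma square_integrable_submod (X : set R) :
  submod_closed [pred f : R -> R[i] | `[< square_integrable X f >]].
Proof.
split.
  apply/asboolP; split => //.
  rewrite integral0_eq ?ltry// => z _; congr (_%:E).
  by rewrite [X in Normc.normc X](_ : _ = 0)// Normc.normc0 expr0n.
move=> c f h; rewrite !inE => -[f0 fi] [h0 hi].
split; first by move=> z Xz; rewrite !fctE f0// h0// scaler0 addr0.
have mX : measurable (X : set (discrete R)) by [].
apply: (@le_lt_trans _ _ (\int[mu]_(z in X)
   ((2 * abs2 c)%:E * (abs2 (f z))%:E + 2%:E * (abs2 (h z))%:E))%E).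
  apply: ge0_le_integral => //.
  - by move=> z _; rewrite lee_fin abs2_ge0.
  - move=> z _; rewrite -!EFinM -EFinD lee_fin (le_trans (abs2D _ _))//.
    by rewrite lerD2r Normc.normcM exprMn mulrA.
have c0 : 0 <= 2 * abs2 c by rewrite mulr_ge0// abs2_ge0.
rewrite ge0_integralD//; last 2 first.
- by move=> z _; rewrite -EFinM lee_fin mulr_ge0// abs2_ge0.
- by move=> z _; rewrite -EFinM lee_fin mulr_ge0// abs2_ge0.
rewrite !ge0_integralZl_EFin//; last 2 first.
- by move=> z _; rewrite lee_fin abs2_ge0.
- by move=> z _; rewrite lee_fin abs2_ge0.
by rewrite lte_add_pinfty// lte_mul_pinfty// ?lee_fin.
Qed.

Definition square_integrable_pred (X : set R) : {pred R -> R[i]} :=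
  [pred f | `[< square_integrable X f >]].

HB.instance Definition _ (X : set R) :=
  GRing.isSubmodClosed.Build R[i] (R -> R[i]) (square_integrable_pred X)
    (square_integrable_submod X).

(* L^2(X, counting measure), that is, l^2(X).  A function on X is extended by 0
   to R.  No quotient is needed: only the empty set is negligible. *)
Record L2 (X : set R) := MkL2 {
  L2fun :> R -> R[i];
  L2P : L2fun \in square_integrable_pred X
}.

HB.instance Definition _ (X : set R) := [isSub for @L2fun X].
HB.instance Definition _ (X : set R) := [Choice of L2 X by <:].
HB.instance Definition _ (X : set R) := [SubChoice_isSubLmodule of L2 X by <:].

Definition L2dot (X : set R) (f h : L2 X) : R[i] :=
  Complex (\int[mu]_(z in X) complex.Re (f z * conjc (h z)))
          (\int[mu]_(z in X) complex.Im (f z * conjc (h z))).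

Definition L2norm (X : set R) (f : L2 X) : R :=
  Num.sqrt (\int[mu]_(z in X) abs2 (f z)).

Lemma square_integrable_indic1 (X : set R) (y : R) :
  X y -> (\1_[set y] : R -> R[i]) \in square_integrable_pred X.
Proof.
move=> Xy; rewrite inE; split.
  by move=> z Xz; rewrite indicE memNset//= => zy; apply: Xz; rewrite zy.
rewrite (_ : (fun z => _) = (fun z => (\1_[set y] z)%:E)).
  rewrite integral_indic//= setIidl; last by move=> _ ->.
  by rewrite /counting_measure /counting asboolT ?ltry.
apply/funext => z; congr (_%:E); rewrite !indicE.
case: (z \in _).
  by rewrite [X in Normc.normc X](_ : _ = 1)// Normc.normc1 expr1n.
by rewrite [X in Normc.normc X](_ : _ = 0)// Normc.normc0 expr0n.
Qed.

(* |y>, the characteristic function of {y} *)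
Definition ket (X : set R) (y : X) : L2 X :=
  MkL2 (square_integrable_indic1 (set_mem (valP y))).

End L2.

Section Representation.
Context (R : realType).

(* rho is a *-homomorphism from A to the algebra of bounded operators on L^2(X);
   it need not be unital. *)
Record is_representation (A : cstarAlgType R) (X : set R)
    (rho : A -> L2 X -> L2 X) : Prop := {
  rep_operator_linear : forall a, linear (rho a);
  rep_operator_bounded : forall a,
    exists M : R, forall f, L2norm (rho a f) <= M * L2norm f;
  rep_linear : forall (c : R[i]) (a b : A) f,
    rho (c *: a + b) f = c *: rho a f + rho b f;
  rep_mul : forall (a b : A) f, rho (cmul a b) f = rho a (rho b f);
  rep_star : forall (a : A) f h,
    L2dot (rho (star a) f) h = L2dot f (rho a h)
}.

Record is_L2_unitary (X Y : set R) (U : L2 X -> L2 Y) : Prop := {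
  unitary_linear : linear U;
  unitary_dot : forall f h, L2dot (U f) (U h) = L2dot f h;
  unitary_surj : forall h, exists f, U f = h
}.

Context (a b : R) (g : markov_map a b) (x : R) (A : cstarAlgType R)
  (s : edge (markov_graph g) -> A) (p : vertex (markov_graph g) -> A).

(* S_ij and P_i are bounded operators given by their values on the basis; the
   value of S_ij is stated as an equality of functions on R, which includes that
   g_i^{-1}(y) belongs to R_g(x) whenever y is in I_j. *)
Record is_nu (nu : A -> L2 (gorbit g x) -> L2 (gorbit g x)) : Prop := {
  nu_representation : is_representation nu;
  nu_edge : forall (e : edge (markov_graph g)) (y : gorbit g x),
    L2fun (nu (s e) (ket y)) =
      (\1_(piece (rng e)) (val y) : R[i]) *:
        (\1_[set branch_inv (src e) (val y)] : R -> R[i]);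
  nu_vertex : forall (i : vertex (markov_graph g)) (y : gorbit g x),
    nu (p i) (ket y) = (\1_(piece i) (val y) : R[i]) *: ket y
}.

Local Notation X := (backward_orbit g x).

Definition bs_D (i : vertex (markov_graph g)) : set R := piece i `&` X.

Definition bs_f (e : edge (markov_graph g)) : R -> R := branch_inv (src e).

Definition bs_R (e : edge (markov_graph g)) : set R :=
  piece (src e) `&` branch (src e) @^-1` (piece (rng e) `&` X).

(* f_e^{-1} : R_e -> D_{r(e)} *)
Definition bs_finv (e : edge (markov_graph g)) : R -> R :=
  'pinv_(fun=> 0) (bs_D (rng e)) (bs_f e).

(* the representation induced by the branching system (D, R, f) *)
Record is_pi (pi : A -> L2 X -> L2 X) : Prop := {
  pi_representation : is_representation pi;
  pi_edge : forall e f,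
    L2fun (pi (s e) f) = (fun z => \1_(bs_R e) z * f (bs_finv e z));
  pi_vertex : forall i f,
    L2fun (pi (p i) f) = (fun z => \1_(bs_D i) z * f z)
}.

End Representation.

(* Main.v *)
Require Import Defs.
From HB Require Import structures.
From mathcomp Require Import all_boot all_order all_algebra.
From mathcomp Require Import finmap.
From mathcomp Require Import all_classical all_reals all_analysis.
From mathcomp Require Import complex.
From mathcomp Require Import ring lra.

(** The map is multivalued only at endpoints of the intervals, and endpoints are
    mapped to endpoints, which never leave the domain.  So the orbit of [x] up to
    its escape point [e], and the orbit of any point that reaches [e], is free of
    endpoints and therefore unique.  A point [y] with [g^k y = g^m x] then reaches
    [e] along the orbit of [x], and conversely every point that reaches [e] meets
    the orbit of [x]: this is the equality [X = Y] ([escape_itinerary],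
    [backward_orbit_gorbit]).

    A representation of the algebra is determined by the images of the
    generators, through its universal property, and a bounded operator with an
    adjoint is determined by its values on the basis ([Bop_eq_ket],
    [representation_unique]).  On the basis vector of [y] in [X], the generator
    [s_ij] acts under [pi] as the function [z |-> 1_R(z) [g_i z = y]], where [R]
    is the set of [z] in [I_i] with [g_i z] in [I_j] and in [X]; since
    [g_i : R -> I_j :&: X] is a bijection, this is the basis vector of
    [g_i^-1 y] if [y] is in [I_j], and 0 otherwise, as for [nu] ([bs_ket]).
    Hence [pi] and [nu] coincide.

    It remains to show that [pi] exists.  The universal property gives a morphism
    into any C*-algebra that contains operators satisfying the relations, here
    the algebra of bounded operators with an adjoint on [L2 X], which is built
    for this purpose: integrals against the counting measure are unordered sums
    ([int_counting_esum]), [L2 X] is complete ([L2_complete]), so its operators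
    are complete for the operator norm ([Bop_complete]), and the C*-identity is
    a form of the Cauchy-Schwarz inequality ([opnorm_star_comp]).  A bijection
    between two subsets of [X] acts as a partial isometry whose adjoint is given
    by the inverse bijection ([substitution_operator]); this provides the
    generators.
    The relations then say that the sets [I_i :&: X] are disjoint, because [X]
    has no endpoints, that [g_i] maps onto [I_j] when [a_ij = 1]
    ([transition_image]), and, for [i] in [V], that every point of [I_i :&: X]
    lies in some [R].  For the last one a point could only fail by escaping
    directly to [e], which the hypothesis on the escape matrix excludes
    ([bs_D_cover]). *)

Set Implicit Arguments.
Unset Strict Implicit.
Unset Printing Implicit Defensive.
Import Order.TTheory GRing.Theory Num.Theory.
Import numFieldNormedType.Exports.
Local Open Scope classical_set_scope.
Local Open Scope ring_scope.

(** * Integrals against the counting measure are unordered sums *)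

Section CountingSums.
Context (R : realType).
Local Notation mu := (counting_measure R).
Implicit Types (X F : set R) (f : R -> R).

Lemma int_counting1 (z : R) f : 0 <= f z ->
  (\int[mu]_(t in [set z]) (f t)%:E = (f z)%:E)%E.
Proof.
move=> fz.
rewrite (eq_integral (fun=> (f z)%:E)); last by move=> t; rewrite inE => ->.
rewrite integral_cst//= [X in (_ * X)%E](_ : _ = 1%E) ?mule1//.
by rewrite /counting_measure /counting asboolT// fset_set1 cardfs1.
Qed.

Lemma int_counting_finite F f : finite_set F -> (forall z, 0 <= f z) ->
  (\int[mu]_(z in F) (f z)%:E = \sum_(z \in F) (f z)%:E)%E.
Proof.
move=> finF f0; rewrite fsbig_finite//=.
have FE : F = \big[setU/set0]_(i <- fset_set F) [set i].
  by rewrite -bigcup_fset bigcup_imset1 image_id fset_setK.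
rewrite {1}FE ge0_integral_bigsetU//.
- by apply: eq_bigr => i _; rewrite int_counting1.
- apply/trivIsetP => i j _ _ ij; rewrite -subset0 => t [/= ->] /eqP.
  by rewrite (negPf ij).
- by move=> z _; rewrite lee_fin.
Qed.

Lemma Rint_counting_support1 X (g : R -> R) (y : R) :
  X y -> (forall z, z != y -> g z = 0) -> \int[mu]_(z in X) g z = g y.
Proof.
move=> Xy g0; transitivity (\int[mu]_(z in [set y]) cst (g y) z).
  rewrite [LHS]Rintegral_mkcond [RHS]Rintegral_mkcond.
  apply: eq_Rintegral => z _; rewrite !patchE.
  have [->|zy] := eqVneq z y; first by rewrite !mem_set.
  by rewrite [z \in [set y]]memNset ?g0 ?if_same//= => /eqP; rewrite (negPf zy).
rewrite Rintegral_cst//= [X in fine X](_ : _ = 1%E) ?mulr1//.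
by rewrite /counting_measure /counting asboolT// fset_set1 cardfs1.
Qed.

Lemma le_fsum_int_counting X F f : finite_set F -> F `<=` X ->
  (forall z, 0 <= f z) ->
  (\sum_(z \in F) (f z)%:E <= \int[mu]_(z in X) (f z)%:E)%E.
Proof.
move=> finF FX f0; rewrite -int_counting_finite//.
by apply: ge0_subset_integral => // z _; rewrite lee_fin.
Qed.

(** Finite subsets give one inequality.  For the other one, if the unordered sum
    is finite then every set [f >= 1/(n+1)] is finite; these sets increase to
    the support of [f], and monotone convergence applies. *)
Lemma int_counting_esum X f : (forall z, 0 <= f z) ->
  (\int[mu]_(z in X) (f z)%:E = \esum_(z in X) (f z)%:E)%E.
Proof.
move=> f0; apply/eqP; rewrite eq_le; apply/andP; split; last first.
  by apply: ge_ereal_sup => _ [F [finF FX] <-]; exact: le_fsum_int_counting.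
have [->|sumoo] := eqVneq (\esum_(z in X) (f z)%:E)%E +oo%E; first exact: leey.
pose A (n : nat) : set R := [set z | X z /\ n.+1%:R^-1 <= f z].
have AX n : A n `<=` X by move=> z [].
have finA n : finite_set (A n).
  apply: contrapT => infA; case/eqP: sumoo; apply: eq_infty => r.
  (* [k] points of [A n] already contribute [k / (n + 1) >= r] *)
  have [k rk] : exists k : nat, r * n.+1%:R <= k%:R.
    by exists (Num.truncn (r * n.+1%:R)).+1; rewrite ltW// truncnS_gt.
  have [B BA kB] := infinite_set_fset k infA.
  apply: esum_ge; exists [set` B]; first by split=> // z /BA/AX.
  rewrite fsbig_finite//= set_fsetK.
  apply: (@le_trans _ _ (\sum_(i <- B) (n.+1%:R^-1)%:E)%E); last first.
    by rewrite !big_seq; apply: lee_sum => i /BA[_]; rewrite lee_fin.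
  rewrite sumEFin lee_fin big_const_seq count_predT iter_addr_0 -mulr_natr.
  rewrite mulr_natr -[_ *+ _]mulr_natr mulrC -(@ler_pM2r _ n.+1%:R) ?ltr0n//.
  rewrite mulfVK ?pnatr_eq0// (le_trans rk)// ler_nat (leq_trans kB)//.
have ndA : nondecreasing_seq A.
  move=> m n mn; apply/subsetPset => z [Xz fz]; split=> //.
  by apply: le_trans fz; rewrite lef_pV2 ?posrE ?ltr0n// ler_nat.
have -> : (\int[mu]_(z in X) (f z)%:E =
           \int[mu]_(z in \bigcup_n A n) (f z)%:E)%E.
  rewrite [LHS]integral_mkcond [RHS]integral_mkcond.
  apply: eq_integral => z _; rewrite !patchE.
  have [Xz|nXz] := asboolP (X z); last first.
    by rewrite !memNset//; move=> [n _ [/nXz]].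
  rewrite (mem_set Xz); have := f0 z; rewrite le_eqVlt => /orP[/eqP<-|fz].
    by case: ifP.
  rewrite mem_set//; exists (Num.truncn (f z)^-1) => //; split => //.
  by rewrite invf_ple ?posrE ?ltr0n// ltW// truncnS_gt.
have cvA : (\int[mu]_(z in A n) (f z)%:E @[n --> \oo] -->
            \int[mu]_(z in \bigcup_n A n) (f z)%:E)%E.
  by apply: ge0_nondecreasing_set_cvg_integral => // n z _; rewrite lee_fin.
apply: (cvge_to_le cvA); apply: nearW => n.
rewrite int_counting_finite//; apply: ereal_sup_ubound.
by exists (A n) => //; split.
Qed.

End CountingSums.

(** * The Hilbert space of square-summable functions *)

Section HilbertSpace.
Context (R : realType).
Local Notation mu := (counting_measure R).
Local Notation abs2 z := (Normc.normc z ^+ 2).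
Implicit Types (X F : set R) (c d : R[i]).

Lemma abs2E c : abs2 c = complex.Re c ^+ 2 + complex.Im c ^+ 2.
Proof. by case: c => p q /=; rewrite sqr_sqrtr// addr_ge0// sqr_ge0. Qed.

Lemma abs2B c d : abs2 (c - d) =
  (complex.Re c - complex.Re d) ^+ 2 + (complex.Im c - complex.Im d) ^+ 2.
Proof. by rewrite abs2E !raddfB. Qed.

Lemma normc_ge0 c : 0 <= Normc.normc c.
Proof. by case: c => p q; exact: sqrtr_ge0. Qed.

Lemma le_Re_normc c : `|complex.Re c| <= Normc.normc c.
Proof.
rewrite -ler_sqr ?nnegrE ?normc_ge0// abs2E -normrX ger0_norm ?sqr_ge0//.
by rewrite lerDl sqr_ge0.
Qed.

Lemma le_Im_normc c : `|complex.Im c| <= Normc.normc c.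
Proof.
rewrite -ler_sqr ?nnegrE ?normc_ge0// abs2E -normrX ger0_norm ?sqr_ge0//.
by rewrite lerDr sqr_ge0.
Qed.

Lemma normcJ c : Normc.normc (conjc c) = Normc.normc c.
Proof. by case: c => p q /=; rewrite sqrrN. Qed.

Lemma normcM_le c d : Normc.normc (c * d) <= abs2 c + abs2 d.
Proof.
rewrite Normc.normcM; have := normc_ge0 c; have := normc_ge0 d.
by move: (Normc.normc c) (Normc.normc d) => p q p0 q0; nra.
Qed.

Lemma mulcJE c : c * conjc c = (abs2 c)%:C%C.
Proof.
rewrite abs2E; case: c => p q; apply/eqP; rewrite eq_complex /=.
by apply/andP; split; apply/eqP; ring.
Qed.

Section OneSet.
Context (X : set R).
Implicit Types (f h k : L2 X) (z : R).

Lemma L2_outside f z : ~ X z -> f z = 0.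
Proof. by move: (L2P f); rewrite inE => -[f0 _]; exact: f0. Qed.

Lemma L2_eqP f h : (forall z, X z -> f z = h z) -> f = h.
Proof.
move=> fh; apply/val_inj/funext => z.
by have [/fh//|nXz] := pselect (X z); rewrite /= !L2_outside.
Qed.

Lemma L2_addE f h : (f + h : L2 X) = (fun z => f z + h z) :> (R -> R[i]).
Proof. by []. Qed.

Lemma L2_subE f h : (f - h : L2 X) = (fun z => f z - h z) :> (R -> R[i]).
Proof. by []. Qed.

Lemma L2_scaleE c f : (c *: f : L2 X) = (fun z => c * f z) :> (R -> R[i]).
Proof. by []. Qed.

(** The product of two square-summable functions is summable, because
    [|c d| <= |c| ^ 2 + |d| ^ 2]; the real and imaginary parts of the inner
    product are then linear as ordinary integrals. *)
Lemma L2_integrable f h (k : R -> R) :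
  (forall z, `|k z| <= Normc.normc (f z * conjc (h z))) ->
  mu.-integrable X (EFin \o k).
Proof.
move=> kfh.
have fi (f' : L2 X) : mu.-integrable X (EFin \o (fun z => abs2 (f' z))).
  apply/integrableP; split => //.
  under eq_integral do rewrite /= ger0_norm ?sqr_ge0//.
  by have := L2P f'; rewrite inE => -[].
apply: le_integrable (integrableD _ (fi f) (fi h)) => //.
move=> z _; rewrite /= lee_fin (le_trans (kfh z))//.
rewrite [leRHS]ger0_norm ?addr_ge0 ?sqr_ge0//.
by rewrite -[in leRHS](normcJ (h z)) normcM_le.
Qed.

Lemma L2_dot_integrable f h :
  mu.-integrable X (EFin \o (fun z => complex.Re (f z * conjc (h z)))) /\
  mu.-integrable X (EFin \o (fun z => complex.Im (f z * conjc (h z)))).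
Proof.
split; apply: (@L2_integrable f h) => z; first exact: le_Re_normc.
exact: le_Im_normc.
Qed.

Lemma Rintegral_linear (t : R) (u v : R -> R) :
  mu.-integrable X (EFin \o u) -> mu.-integrable X (EFin \o v) ->
  mu.-integrable X (EFin \o (fun z => t * u z + v z)) /\
  \int[mu]_(z in X) (t * u z + v z) =
    t * (\int[mu]_(z in X) u z) + \int[mu]_(z in X) v z.
Proof.
move=> iu iv.
have itu : mu.-integrable X (EFin \o (fun z => t * u z)).
  have := integrableZl _ t iu; exact.
split; first by have := integrableD _ itu iv; exact.
by rewrite RintegralD// RintegralZl.
Qed.

Lemma L2dot_linear c f h k :
  L2dot (c *: f + h) k = c * L2dot f k + L2dot h k.
Proof.
have [rf jf] := L2_dot_integrable f k; have [rh jh] := L2_dot_integrable h k.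
case: c => p q; rewrite /L2dot; congr Complex.
- have [i1 e1] := Rintegral_linear (- q) jf rh.
  have [_ e2] := Rintegral_linear p rf i1.
  rewrite -addrA -mulNr -e1 -e2; apply: eq_Rintegral => z _.
  rewrite L2_addE L2_scaleE.
  by case: (f z) (h z) (k z) => ? ? [? ?] [? ?] /=; ring.
- have [i1 e1] := Rintegral_linear q rf jh.
  have [_ e2] := Rintegral_linear p jf i1.
  rewrite -addrA -e1 -e2; apply: eq_Rintegral => z _.
  rewrite L2_addE L2_scaleE.
  by case: (f z) (h z) (k z) => ? ? [? ?] [? ?] /=; ring.
Qed.

Lemma L2dotC f h : L2dot h f = conjc (L2dot f h).
Proof.
have [rf jf] := L2_dot_integrable f h.
rewrite /L2dot /=; congr Complex.
  by apply: eq_Rintegral => z _; case: (f z) (h z) => p q [r t] /=; ring.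
rewrite -mulN1r -RintegralZl//.
by apply: eq_Rintegral => z _; case: (f z) (h z) => p q [r t] /=; ring.
Qed.

(** The squared norm is the supremum of finite partial sums: this is the form in
    which it is bounded, passed to the limit and reindexed. *)
Lemma L2norm_esum f :
  ((L2norm f ^+ 2)%:E = \esum_(z in X) (abs2 (f z))%:E)%E.
Proof.
have := L2P f; rewrite inE => -[_ finf].
rewrite sqr_sqrtr; last by apply: Rintegral_ge0 => z _; exact: sqr_ge0.
rewrite /Rintegral fineK; first by apply: int_counting_esum => z; exact: sqr_ge0.
by rewrite ge0_fin_numE//; apply: integral_ge0 => z _; rewrite lee_fin sqr_ge0.
Qed.

Lemma L2dot_norm f : L2dot f f = (L2norm f ^+ 2)%:C%C.
Proof.
rewrite sqr_sqrtr; last by apply: Rintegral_ge0 => z _; exact: sqr_ge0.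
congr Complex; first by apply: eq_Rintegral => z _; rewrite mulcJE.
by rewrite /Rintegral integral0_eq// => z _; rewrite mulcJE.
Qed.

Lemma L2dotDl f h k : L2dot (f + h) k = L2dot f k + L2dot h k.
Proof. by rewrite -[f in LHS]scale1r L2dot_linear mul1r. Qed.

Lemma L2dot0l h : L2dot 0 h = 0.
Proof. by apply: (addrI (L2dot 0 h)); rewrite -L2dotDl !addr0. Qed.

Lemma L2dotZl c f k : L2dot (c *: f) k = c * L2dot f k.
Proof. by rewrite -[c *: f]addr0 L2dot_linear L2dot0l addr0. Qed.

Lemma L2dotBl f h k : L2dot (f - h) k = L2dot f k - L2dot h k.
Proof. by rewrite L2dotDl -scaleN1r L2dotZl mulN1r. Qed.

Lemma L2dotDr k f h : L2dot k (f + h) = L2dot k f + L2dot k h.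
Proof. by rewrite L2dotC L2dotDl rmorphD (L2dotC f) (L2dotC h). Qed.

Lemma L2dotZr c k f : L2dot k (c *: f) = conjc c * L2dot k f.
Proof. by rewrite L2dotC L2dotZl rmorphM (L2dotC f). Qed.

Lemma L2dotBr k f h : L2dot k (f - h) = L2dot k f - L2dot k h.
Proof. by rewrite L2dotC L2dotBl rmorphB (L2dotC f) (L2dotC h). Qed.

Lemma L2norm_ge0 f : 0 <= L2norm f.
Proof. exact: sqrtr_ge0. Qed.

Lemma L2dot_ket f (y : X) : L2dot f (ket y) = f (val y).
Proof.
have Xy := set_mem (valP y).
have ky (z : R) : z != val y -> ket y z = 0.
  by move=> zy; rewrite /= indicE memNset//= => /eqP; rewrite (negPf zy).
have -> : f (val y) = f (val y) * conjc (ket y (val y)).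
  by rewrite /= indicE mem_set// conjc1 mulr1.
by apply/eqP; rewrite eq_complex /=; apply/andP; split; apply/eqP;
  apply: (Rint_counting_support1
    (g := fun z => _ (f z * conjc (ket y z))) Xy) => z /ky->;
  rewrite conjc0 mulr0.
Qed.

Lemma le_fsum_L2norm f F : finite_set F -> F `<=` X ->
  \sum_(z <- fset_set F) abs2 (f z) <= L2norm f ^+ 2.
Proof.
move=> finF FX; rewrite -lee_fin L2norm_esum -sumEFin -fsbig_finite//.
by apply: ereal_sup_ubound; exists F.
Qed.

Lemma normc_le_L2norm f z : Normc.normc (f z) <= L2norm f.
Proof.
have [Xz|nXz] := pselect (X z); last first.
  by rewrite L2_outside// Normc.normc0 L2norm_ge0.
rewrite -ler_sqr ?nnegrE ?normc_ge0 ?L2norm_ge0//.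
have := @le_fsum_L2norm f [set z] (finite_set1 z); rewrite fset_set1 big_seq_fset1.
by apply => t ->.
Qed.

Lemma L2norm_eq0 f : L2norm f = 0 -> f = 0.
Proof.
move=> f0; apply: L2_eqP => z _; apply: Normc.eq0_normc; apply/eqP.
by rewrite eq_le normc_ge0 andbT -f0 normc_le_L2norm.
Qed.

Lemma L2norm0 : L2norm (0 : L2 X) = 0.
Proof.
have := L2dot_norm 0; rewrite L2dot0l => -[/esym/eqP].
by rewrite sqrf_eq0 => /eqP.
Qed.

Lemma L2normZ c f : L2norm (c *: f) = Normc.normc c * L2norm f.
Proof.
apply: (pexpIrn (n := 2)); rewrite ?nnegrE ?mulr_ge0 ?normc_ge0 ?L2norm_ge0//.
apply: complexI; rewrite -L2dot_norm L2dotZl L2dotZr mulrA mulcJE L2dot_norm.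
by rewrite exprMn [RHS]rmorphM.
Qed.

(** The squared norm of [f - c h] is nonnegative for
    [c = <f, h> / |h| ^ 2], the best approximation of [f] on the line of [h]. *)
Lemma L2_CauchySchwarz f h : Normc.normc (L2dot f h) <= L2norm f * L2norm h.
Proof.
have [h0|h0] := eqVneq (L2norm h) 0.
  rewrite (L2norm_eq0 h0) L2dotC L2dot0l conjc0 Normc.normc0.
  by rewrite mulr_ge0 ?L2norm_ge0.
have hp : 0 < L2norm h by rewrite lt_neqAle eq_sym h0 L2norm_ge0.
rewrite -ler_sqr ?nnegrE ?normc_ge0 ?mulr_ge0 ?L2norm_ge0// exprMn.
set d := L2dot f h; pose c := d * ((L2norm h ^- 2)%:C)%C.
have : (0 : R[i]) <= L2dot (f - c *: h) (f - c *: h).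
  by rewrite L2dot_norm ler0c sqr_ge0.
have -> : L2dot (f - c *: h) (f - c *: h) =
    (L2norm f ^+ 2 - abs2 d / L2norm h ^+ 2)%:C%C.
  transitivity
      ((L2norm f ^+ 2)%:C - d * conjc d * (L2norm h ^- 2)%:C)%C; last first.
    by rewrite mulcJE -[X in _ - X]rmorphM -rmorphB.
  have e : ((L2norm h ^- 2)%:C * (L2norm h ^+ 2)%:C = 1 :> R[i])%C.
    by rewrite -[LHS]rmorphM mulVf ?rmorph1// expf_neq0.
  have cJ : conjc c = conjc d * (L2norm h ^- 2)%:C%C.
    by rewrite [LHS]rmorphM; congr (_ * _); exact: conjc_real.
  rewrite !(L2dotBl, L2dotBr, L2dotZl, L2dotZr) (L2dotC f h) !L2dot_norm.
  rewrite -/d cJ /c.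
  move: e; move: (L2norm h ^- 2)%:C%C (L2norm h ^+ 2)%:C%C => u v e.
  have -> : d * u * (conjc d * u * v) = d * conjc d * u * (u * v) by ring.
  by rewrite e; ring.
rewrite ler0c subr_ge0 ler_pdivrMr ?exprn_gt0//.
Qed.

Lemma ler_L2normD f h : L2norm (f + h) <= L2norm f + L2norm h.
Proof.
rewrite -ler_sqr ?nnegrE ?addr_ge0 ?L2norm_ge0//.
have -> : L2norm (f + h) ^+ 2 =
    L2norm f ^+ 2 + L2norm h ^+ 2 + 2 * complex.Re (L2dot f h).
  have := L2dot_norm (f + h).
  rewrite L2dotDl !L2dotDr (L2dotC f h) !L2dot_norm.
  by case: (L2dot f h) => p q [<- _] /=; ring.
have := L2_CauchySchwarz f h; have := le_Re_normc (L2dot f h).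
by rewrite ler_norml => /andP[_ ]; nra.
Qed.

Lemma L2normN f : L2norm (- f) = L2norm f.
Proof. by rewrite -scaleN1r L2normZ normcN Normc.normc1 mul1r. Qed.

End OneSet.
End HilbertSpace.

Section Completeness.
Context (R : realType) (X : set R) (I : Type) (F : set_system I)
  (FF : ProperFilter F).
Local Notation abs2 c := (Normc.normc c ^+ 2).

Lemma real_cauchy_cvg (v : I -> R) :
  (forall e : R, 0 < e -> exists2 S, F S &
     forall i j, S i -> S j -> `|v i - v j| <= e) ->
  cvg (v @ F).
Proof.
move=> cauchy_v; apply: R_complete; apply: cauchy_exP => e e0.
have [S FS Se] := cauchy_v (e / 2) (divr_gt0 e0 (ltr0Sn _ 1)).
have [i Si] := filter_ex FS; exists (v i).
apply: (filterS (Q := v @^-1` ball (v i) e) _ FS) => j Sj.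
rewrite /= -ball_normE /=.
apply: le_lt_trans (Se _ _ Si Sj) _.
by rewrite gtr_pMr// invf_lt1// ltr1n.
Qed.

Lemma fsum_le_square_integrable (f : R -> R[i]) (M : R) :
  (forall z, ~ X z -> f z = 0) ->
  (forall D, finite_set D -> D `<=` X ->
     \sum_(z <- fset_set D) abs2 (f z) <= M) ->
  exists2 h : L2 X, h = f :> (R -> R[i]) & L2norm h ^+ 2 <= M.
Proof.
move=> f0 fM.
have sum_le : (\esum_(z in X) (abs2 (f z))%:E <= M%:E)%E.
  apply: ge_ereal_sup => _ [D [finD DX] <-].
  by rewrite fsbig_finite// sumEFin lee_fin fM.
have fP : f \in square_integrable_pred X.
  rewrite inE; split=> //.
  rewrite int_counting_esum; last by move=> z; exact: sqr_ge0.
  exact: le_lt_trans sum_le (ltry _).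
by exists (MkL2 fP) => //; rewrite -lee_fin L2norm_esum.
Qed.

(** The pointwise limit is also the limit in norm: the finite partial sums of
    [|u i - u j| ^ 2] are bounded by [e ^ 2], a bound that survives the limit in
    [j].  The conclusion holds for every Cauchy set [S] with its own [e], and not
    only eventually: applied to [T |-> T f] for a Cauchy filter of operators it
    then gives an estimate with the same [S] for all [f]. *)
Lemma L2_complete (u : I -> L2 X) :
  (forall e : R, 0 < e -> exists2 S, F S &
     forall i j, S i -> S j -> L2norm (u i - u j) <= e) ->
  exists l : L2 X, forall S e, F S ->
    (forall i j, S i -> S j -> L2norm (u i - u j) <= e) ->
    forall i, S i -> L2norm (u i - l) <= e.
Proof.
move=> cauchy_u.
have cvg_re z : cvg ((fun i => complex.Re (u i z)) @ F).
  apply: real_cauchy_cvg => e /cauchy_u[S FS Se]; exists S => // i j Si Sj.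
  rewrite -raddfB; apply: le_trans (le_Re_normc _) _.
  exact: le_trans (normc_le_L2norm (u i - u j) z) (Se _ _ Si Sj).
have cvg_im z : cvg ((fun i => complex.Im (u i z)) @ F).
  apply: real_cauchy_cvg => e /cauchy_u[S FS Se]; exists S => // i j Si Sj.
  rewrite -raddfB; apply: le_trans (le_Im_normc _) _.
  exact: le_trans (normc_le_L2norm (u i - u j) z) (Se _ _ Si Sj).
pose l z := Complex (lim ((fun i => complex.Re (u i z)) @ F))
                    (lim ((fun i => complex.Im (u i z)) @ F)).
have bound S e i : F S -> (forall i j, S i -> S j -> L2norm (u i - u j) <= e) ->
    S i -> forall D, finite_set D -> D `<=` X ->
    \sum_(z <- fset_set D) abs2 (u i z - l z) <= e ^+ 2.
  move=> FS Se Si D finD DX.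
  have cvg_sum : (\sum_(z <- fset_set D) abs2 (u i z - u j z)) @[j --> F] -->
                 \sum_(z <- fset_set D) abs2 (u i z - l z).
    apply: cvg_big => // [|z _]; first exact: add_continuous.
    rewrite abs2B; under eq_fun do rewrite abs2B.
    apply: cvgD; rewrite expr2; under eq_fun do rewrite expr2.
      by apply: cvgM; apply: cvgB; (exact: cvg_cst || exact: cvg_re).
    by apply: cvgM; apply: cvgB; (exact: cvg_cst || exact: cvg_im).
  apply: (cvgr_to_le cvg_sum); apply: filterS FS => j Sj.
  apply: le_trans (le_fsum_L2norm (u i - u j) finD DX) _.
  rewrite ler_sqr ?nnegrE ?L2norm_ge0 ?Se//.
  exact: le_trans (L2norm_ge0 _) (Se _ _ Si Sj).
have l0 z : ~ X z -> l z = 0.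
  move=> Xz; rewrite /l (_ : (fun i => complex.Re (u i z)) = fun=> 0); last first.
    by apply/funext => i; rewrite L2_outside.
  rewrite (_ : (fun i => complex.Im (u i z)) = fun=> 0) ?lim_cst//.
  by apply/funext => i; rewrite L2_outside.
have diff S e i : F S -> (forall i j, S i -> S j -> L2norm (u i - u j) <= e) ->
    S i -> exists2 h : L2 X, h = (fun z => u i z - l z) :> (R -> R[i]) &
      L2norm h <= e.
  move=> FS Se Si.
  have [|h hE hM] := fsum_le_square_integrable _ (bound _ _ _ FS Se Si).
    by move=> z Xz; rewrite L2_outside// l0// subr0.
  exists h => //; rewrite -ler_sqr// nnegrE ?L2norm_ge0//.
  exact: le_trans (L2norm_ge0 _) (Se _ _ Si Si).
have [S1 FS1 S1e] := cauchy_u 1 ltr01.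
have [i1 Si1] := filter_ex FS1.
have [h1 h1E _] := diff _ _ _ FS1 S1e Si1.
exists (u i1 - h1) => S e FS Se i Si.
have [h hE he] := diff _ _ _ FS Se Si.
rewrite (_ : u i - (u i1 - h1) = h)//; apply: L2_eqP => z _.
by rewrite L2_subE hE L2_subE h1E; ring.
Qed.

End Completeness.

(** * The C*-algebra of adjointable bounded operators *)

Section Operators.
Context (R : realType) (X : set R).
Implicit Types (f h k : L2 X) (T S : L2 X -> L2 X) (M : R).

Definition adjoint_to T S := forall f h, L2dot (T f) h = L2dot f (S h).

Definition bounded_by T M := 0 <= M /\ forall f, L2norm (T f) <= M * L2norm f.

Lemma L2_nondegenerate f h : (forall k, L2dot f k = L2dot h k) -> f = h.
Proof.
move=> fh; apply: L2_eqP => z Xz.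
by have := fh (ket (SigSub (mem_set Xz))); rewrite !L2dot_ket.
Qed.

Lemma adjoint_sym T S : adjoint_to T S -> adjoint_to S T.
Proof. by move=> TS f h; rewrite L2dotC -TS -L2dotC. Qed.

Lemma adjoint_unique T S S' : adjoint_to T S -> adjoint_to T S' -> S = S'.
Proof.
move=> TS TS'; apply/funext => h; apply: L2_nondegenerate => k.
by rewrite (adjoint_sym TS) (adjoint_sym TS').
Qed.

Lemma adjoint_linear T S : adjoint_to T S -> linear T.
Proof.
move=> TS c f h; apply: L2_nondegenerate => k.
by rewrite TS !L2dot_linear !TS.
Qed.

(** [|S f| ^ 2 = <T (S f), f> <= M |S f| |f|]. *)
Lemma adjoint_bounded T S M :
  adjoint_to T S -> bounded_by T M -> bounded_by S M.
Proof.
move=> TS [M0 TM]; split=> // f.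
have [->|Sf] := eqVneq (L2norm (S f)) 0; first by rewrite mulr_ge0 ?L2norm_ge0.
have Sf0 : 0 < L2norm (S f) by rewrite lt_neqAle eq_sym Sf L2norm_ge0.
rewrite -(ler_pM2l Sf0) -expr2 -lecR -L2dot_norm -TS.
have -> : L2norm (S f) * (M * L2norm f) = (M * L2norm (S f)) * L2norm f by ring.
have TSf0 : 0 <= L2dot (T (S f)) f by rewrite TS L2dot_norm ler0c sqr_ge0.
rewrite -(ger0_norm TSf0) lecR.
apply: le_trans (L2_CauchySchwarz _ _) _.
by rewrite ler_wpM2r ?L2norm_ge0.
Qed.

(** Asking for an adjoint makes the operator linear, and gives the involution
    of the algebra without the Riesz representation theorem. *)
Definition bounded_adjointable T :=
  (exists M, bounded_by T M) /\ exists S, adjoint_to T S.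

Lemma bounded_adjointable_submod :
  submod_closed [pred T | `[< bounded_adjointable T >]].
Proof.
split.
  rewrite inE; split; first by exists 0; split => // f; rewrite L2norm0 mul0r.
  by exists (fun=> 0) => f h; rewrite [LHS]L2dot0l L2dotC L2dot0l conjc0.
move=> c T T'; rewrite !inE => -[[M [M0 TM]] [S TS]] [[M' [M'0 TM']] [S' TS']].
split.
  exists (Normc.normc c * M + M'); split.
    by rewrite addr_ge0 ?mulr_ge0 ?normc_ge0.
  move=> f; apply: le_trans (ler_L2normD _ _) _.
  by rewrite mulrDl lerD// L2normZ -mulrA ler_wpM2l ?normc_ge0.
exists (fun h => conjc c *: S h + S' h) => f h.
by rewrite L2dotDl L2dotZl L2dotDr L2dotZr conjcK TS TS'.
Qed.

Definition bounded_adjointable_pred : {pred L2 X -> L2 X} :=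
  [pred T | `[< bounded_adjointable T >]].

HB.instance Definition _ :=
  GRing.isSubmodClosed.Build R[i] (L2 X -> L2 X) bounded_adjointable_pred
    bounded_adjointable_submod.

Record Bop := MkBop {
  bopfun :> L2 X -> L2 X;
  bopP : bopfun \in bounded_adjointable_pred
}.

HB.instance Definition _ := [isSub for bopfun].
HB.instance Definition _ := [Choice of Bop by <:].
HB.instance Definition _ := [SubChoice_isSubLmodule of Bop by <:].

End Operators.

Section OperatorAlgebra.
Context (R : realType) (X : set R).
Implicit Types (f h k : L2 X) (T S : Bop X) (M e : R).

Lemma Bop_bounded T : exists M, bounded_by T M.
Proof. by have := bopP T; rewrite inE => -[]. Qed.

Lemma Bop_adjointable T : exists S : L2 X -> L2 X, adjoint_to T S.
Proof. by have := bopP T; rewrite inE => -[]. Qed.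

Lemma Bop_linear T : linear T.
Proof. by have [S /adjoint_linear] := Bop_adjointable T. Qed.

Lemma Bop_eqP T S : (forall f, T f = S f) -> T = S.
Proof. by move=> TS; apply/val_inj/funext. Qed.

Lemma Bop_addE T S f : (T + S : Bop X) f = T f + S f. Proof. by []. Qed.
Lemma Bop_subE T S f : (T - S : Bop X) f = T f - S f. Proof. by []. Qed.
Lemma Bop_scaleE c T f : (c *: T : Bop X) f = c *: T f. Proof. by []. Qed.

Definition bounds T : set R := [set M | bounded_by T M].

Definition opnorm T : R := inf (bounds T).

Lemma has_inf_bounds T : has_inf (bounds T).
Proof.
split; first by have [M TM] := Bop_bounded T; exists M.
by exists 0 => M [].
Qed.

Lemma opnorm_ge0 T : 0 <= opnorm T.
Proof.
by apply: lb_le_inf => [|M []//]; have [] := has_inf_bounds T.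
Qed.

Lemma opnorm_le T M : bounded_by T M -> opnorm T <= M.
Proof. by move=> TM; apply: ge_inf => //; have [] := has_inf_bounds T. Qed.

(** The infimum is attained: a bound for [T] cannot be smaller than any quotient
    [|T f| / |f|]. *)
Lemma opnormP T f : L2norm (T f) <= opnorm T * L2norm f.
Proof.
have [f0|f0] := eqVneq (L2norm f) 0.
  have [M [_ /(_ f)]] := Bop_bounded T.
  by rewrite f0 !mulr0.
have fp : 0 < L2norm f by rewrite lt_neqAle eq_sym f0 L2norm_ge0.
rewrite -ler_pdivrMr//; apply: lb_le_inf.
  by have [] := has_inf_bounds T.
by move=> M [_ TM]; rewrite ler_pdivrMr.
Qed.

Lemma opnorm_bounded T : bounded_by T (opnorm T).
Proof. by split; [exact: opnorm_ge0|exact: opnormP]. Qed.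

Lemma opnormD T S : opnorm (T + S) <= opnorm T + opnorm S.
Proof.
apply: opnorm_le; split=> [|f]; first by rewrite addr_ge0// opnorm_ge0.
by rewrite Bop_addE (le_trans (ler_L2normD _ _))// mulrDl lerD// opnormP.
Qed.

Lemma opnormZ c T : opnorm (c *: T) = Normc.normc c * opnorm T.
Proof.
have le_opnormZ d S : opnorm (d *: S) <= Normc.normc d * opnorm S.
  apply: opnorm_le; split=> [|f].
    by rewrite mulr_ge0 ?normc_ge0 ?opnorm_ge0.
  by rewrite Bop_scaleE L2normZ -mulrA ler_wpM2l ?normc_ge0// opnormP.
apply/eqP; rewrite eq_le le_opnormZ/=.
have [->|c0] := eqVneq c 0; first by rewrite Normc.normc0 mul0r opnorm_ge0.
have nc0 : 0 < Normc.normc c.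
  rewrite lt_neqAle normc_ge0 andbT eq_sym; apply: contra_neq c0.
  exact: Normc.eq0_normc.
rewrite -ler_pdivlMl//; have := le_opnormZ c^-1 (c *: T).
by rewrite scalerA mulVf// scale1r Normc.normcV.
Qed.

Lemma opnorm_eq0 T : opnorm T = 0 -> T = 0.
Proof.
move=> T0; apply: Bop_eqP => f; apply: L2norm_eq0; apply/eqP.
by rewrite eq_le L2norm_ge0 andbT (le_trans (opnormP _ _))// T0 mul0r.
Qed.

Definition bop_norm T : R[i] := (opnorm T)%:C%C.

Lemma bop_normD T S : bop_norm (T + S) <= bop_norm T + bop_norm S.
Proof. by rewrite /bop_norm -rmorphD lecR opnormD. Qed.

Lemma bop_normZ c T : bop_norm (c *: T) = `|c| * bop_norm T.
Proof. by rewrite /bop_norm opnormZ rmorphM. Qed.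

Lemma bop_norm_eq0 T : bop_norm T = 0 -> T = 0.
Proof. by move=> T0; apply: opnorm_eq0; apply: complexI. Qed.

HB.instance Definition _ :=
  Lmodule_isNormed.Build R[i] (Bop X) bop_normD bop_normZ bop_norm_eq0.

Lemma bop_normE T : `|T| = (opnorm T)%:C%C. Proof. by []. Qed.

Definition bop_adjoint_fun T : L2 X -> L2 X := projT1 (cid (Bop_adjointable T)).

Lemma bop_adjoint_funP T : adjoint_to T (bop_adjoint_fun T).
Proof. exact: projT2 (cid (Bop_adjointable T)). Qed.

Lemma bop_adjoint_subproof T :
  bop_adjoint_fun T \in @bounded_adjointable_pred R X.
Proof.
have TS := bop_adjoint_funP T; rewrite inE; split; last first.
  by exists T; exact: adjoint_sym.
by exists (opnorm T); exact: adjoint_bounded (opnorm_bounded T).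
Qed.

Definition bop_adjoint T : Bop X := MkBop (bop_adjoint_subproof T).

Lemma bop_adjointP T : adjoint_to T (bop_adjoint T).
Proof. exact: bop_adjoint_funP. Qed.

Lemma bop_adjoint_eq T S : adjoint_to T S -> bop_adjoint T = S.
Proof.
by move=> TS; apply: val_inj; exact: adjoint_unique (bop_adjointP T) TS.
Qed.

Lemma bop_comp_subproof T S : T \o S \in @bounded_adjointable_pred R X.
Proof.
rewrite inE; split.
  exists (opnorm T * opnorm S); split=> [|f].
    by rewrite mulr_ge0 ?opnorm_ge0.
  rewrite -mulrA (le_trans (opnormP T _))// ler_wpM2l ?opnorm_ge0//.
  exact: opnormP.
by exists (bop_adjoint S \o bop_adjoint T) => f h; rewrite /= !bop_adjointP.
Qed.

Definition bop_comp T S : Bop X := MkBop (bop_comp_subproof T S).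

Lemma bop_adjointK : involutive bop_adjoint.
Proof.
by move=> T; apply: bop_adjoint_eq; apply: adjoint_sym; exact: bop_adjointP.
Qed.

Lemma opnorm_comp T S : opnorm (bop_comp T S) <= opnorm T * opnorm S.
Proof.
apply: opnorm_le; split=> [|f]; first by rewrite mulr_ge0 ?opnorm_ge0.
by rewrite -mulrA (le_trans (opnormP T _))// ler_wpM2l ?opnorm_ge0// opnormP.
Qed.

Lemma opnorm_adjoint T : opnorm (bop_adjoint T) = opnorm T.
Proof.
have le_adj S : opnorm (bop_adjoint S) <= opnorm S.
  by apply: opnorm_le; apply: adjoint_bounded (bop_adjointP S) (opnorm_bounded S).
by apply/eqP; rewrite eq_le le_adj -{1}(bop_adjointK T) le_adj.
Qed.

(** [|T f| ^ 2 = <f, T^* T f> <= |T^* T| |f| ^ 2]. *)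
Lemma opnorm_star_comp T : opnorm (bop_comp (bop_adjoint T) T) = opnorm T ^+ 2.
Proof.
apply/eqP; rewrite eq_le; apply/andP; split.
  by rewrite (le_trans (opnorm_comp _ _))// opnorm_adjoint.
set N := opnorm (bop_comp _ _); have N0 : 0 <= N by exact: opnorm_ge0.
rewrite -[leRHS](sqr_sqrtr N0) ler_sqr ?nnegrE ?sqrtr_ge0 ?opnorm_ge0//.
apply: opnorm_le; split=> [|f]; first exact: sqrtr_ge0.
rewrite -ler_sqr ?nnegrE ?mulr_ge0 ?sqrtr_ge0 ?L2norm_ge0// exprMn (sqr_sqrtr N0).
have -> : L2norm (T f) ^+ 2 =
    Normc.normc (L2dot f (bop_comp (bop_adjoint T) T f)).
  rewrite -bop_adjointP L2dot_norm /= expr0n addr0 sqrtr_sqr.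
  by rewrite ger0_norm// sqr_ge0.
apply: le_trans (L2_CauchySchwarz _ _) _.
by rewrite mulrC expr2 mulrA ler_wpM2r ?L2norm_ge0// opnormP.
Qed.

Lemma bop_adjointD : {morph bop_adjoint : T S / T + S}.
Proof.
move=> T S; apply: bop_adjoint_eq => f h.
by rewrite !Bop_addE L2dotDl L2dotDr !bop_adjointP.
Qed.

Lemma bop_adjointZ c T : bop_adjoint (c *: T) = conjc c *: bop_adjoint T.
Proof.
apply: bop_adjoint_eq => f h.
by rewrite !Bop_scaleE L2dotZl L2dotZr conjcK bop_adjointP.
Qed.

Lemma bop_adjointB : {morph bop_adjoint : T S / T - S}.
Proof.
move=> T S; rewrite bop_adjointD -scaleN1r bop_adjointZ rmorphN1.
by rewrite scaleN1r.
Qed.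

(** A Cauchy filter of operators converges pointwise, and so do the adjoints;
    the two pointwise limits are adjoint to each other. *)
Lemma Bop_complete (F : set_system (Bop X)) :
  ProperFilter F -> cauchy F -> cvg F.
Proof.
move=> FF /cauchyP cauchyF.
have {}cauchyF e : 0 < e -> exists2 S, F S &
    forall T T', S T -> S T' -> opnorm (T - T') <= e.
  move=> e0; have [|T0 FT0] := cauchyF (e / 2)%:C%C.
    by rewrite ltcR divr_gt0.
  exists (ball T0 (e / 2)%:C%C) => // T T'.
  rewrite -ball_normE /ball_/= !bop_normE !ltcR.
  move=> T0T T0T'; rewrite -lecR -bop_normE (le_trans (ler_distD T0 _ _))//.
  by rewrite distrC !bop_normE -rmorphD lecR; lra.
have lim_of (u : Bop X -> Bop X) :
    (forall T T', opnorm (u T - u T') = opnorm (T - T')) ->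
    exists l : L2 X -> L2 X, forall (S : set (Bop X)) e, F S ->
      (forall T T', S T -> S T' -> opnorm (T - T') <= e) ->
      forall T f, S T -> L2norm (u T f - l f) <= e * L2norm f.
  move=> uN.
  have H f : exists l : L2 X, forall (S : set (Bop X)) e, F S ->
      (forall T T', S T -> S T' -> opnorm (T - T') <= e) ->
      forall T, S T -> L2norm (u T f - l) <= e * L2norm f.
    have [e e0|l lP] := @L2_complete _ X _ F FF (fun T => u T f).
      have [|S FS Se] := cauchyF (e / (L2norm f + 1)).
        by rewrite divr_gt0// ltr_wpDl ?L2norm_ge0.
      exists S => // T T' ST ST'; rewrite -Bop_subE.
      apply: le_trans (opnormP _ _) _; rewrite uN.
      apply: le_trans (ler_wpM2r (L2norm_ge0 _) (Se _ _ ST ST')) _.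
      rewrite mulrAC ler_pdivrMr ?ltr_wpDl ?L2norm_ge0//.
      by apply: ler_wpM2l; [exact: ltW|rewrite lerDl].
    exists l => S e FS Se T ST; apply: (lP S) => // T1 T2 ST1 ST2.
    rewrite -Bop_subE; apply: le_trans (opnormP _ _) _.
    by rewrite uN ler_wpM2r ?L2norm_ge0// Se.
  by exists (fun f => projT1 (cid (H f))) => S e FS Se T f ST;
    exact: (projT2 (cid (H f)) S).
have [l lP] := lim_of id (fun _ _ => erefl).
have [|l' l'P] := lim_of bop_adjoint.
  by move=> T T'; rewrite -bop_adjointB opnorm_adjoint.
have ll' : adjoint_to l l'.
  move=> f h; apply/eqP; rewrite -subr_eq0; apply/eqP/Normc.eq0_normc/eqP.
  rewrite eq_le normc_ge0 andbT; apply/ler_addgt0Pl => e e0; rewrite addr0.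
  (* the [+ 1] keeps the denominator positive when [f] or [h] vanishes *)
  pose d := e / (2 * (L2norm f * L2norm h) + 1).
  have fh : 0 <= L2norm f * L2norm h by rewrite mulr_ge0 ?L2norm_ge0.
  have [|S FS Sd] := cauchyF d; first by rewrite divr_gt0//; lra.
  have [T ST] := filter_ex FS.
  have -> : L2dot (l f) h - L2dot f (l' h) =
      L2dot f (bop_adjoint T h - l' h) - L2dot (T f - l f) h.
    by rewrite L2dotBl L2dotBr bop_adjointP; ring.
  apply: le_trans (le_normcD _ _) _; rewrite normcN.
  have lf := le_trans (L2_CauchySchwarz (T f - l f) h)
    (ler_wpM2r (L2norm_ge0 h) (lP _ _ FS Sd _ f ST)).
  have l'h := le_trans (L2_CauchySchwarz f (bop_adjoint T h - l' h))
    (ler_wpM2l (L2norm_ge0 f) (l'P _ _ FS Sd _ h ST)).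
  apply: le_trans (lerD l'h lf) _.
  rewrite (_ : _ + _ = d * (2 * (L2norm f * L2norm h))); last by ring.
  by rewrite /d mulrAC ler_pdivrMr; [rewrite ler_wpM2l//; lra|lra].
have lb : l \in @bounded_adjointable_pred R X.
  rewrite inE; split; last by exists l'.
  have [S FS S1] := cauchyF 1 ltr01; have [T ST] := filter_ex FS.
  exists (opnorm T + 1); split=> [|f]; first by rewrite addr_ge0 ?opnorm_ge0.
  have -> : l f = T f - (T f - l f) by rewrite subKr.
  apply: le_trans (ler_L2normD _ _) _; rewrite L2normN mulrDl lerD ?opnormP//.
  exact: (lP _ _ FS S1 _ _ ST).
apply/cvg_ex; exists (MkBop lb); apply/cvgrPdist_le => e e0.
have [r re] : exists r : R, e = r%:C%C.
  by exists (complex.Re e); rewrite RRe_real// gtr0_real.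
have r0 : 0 < r by rewrite -ltcR -re.
have [S FS Sr] := cauchyF r r0.
apply: (filterS _ (FS)) => T ST; rewrite distrC bop_normE re lecR.
apply: opnorm_le; split=> [|f]; first exact: ltW.
exact: (lP _ _ FS Sr _ _ ST).
Qed.

HB.instance Definition _ := Uniform_isComplete.Build (Bop X) Bop_complete.

Lemma bop_compA : associative bop_comp.
Proof. by move=> T S U; exact: Bop_eqP. Qed.

Lemma bop_compDl : left_distributive bop_comp +%R.
Proof. by move=> T S U; exact: Bop_eqP. Qed.

Lemma bop_compDr : right_distributive bop_comp +%R.
Proof.
move=> T S U; apply: Bop_eqP => f.
by have := Bop_linear T 1 (S f) (U f); rewrite !scale1r.
Qed.

Lemma bop_compZl c T S : bop_comp (c *: T) S = c *: bop_comp T S.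
Proof. exact: Bop_eqP. Qed.

Lemma bop_compZr c T S : bop_comp T (c *: S) = c *: bop_comp T S.
Proof.
apply: Bop_eqP => f; have T0 : T 0 = 0.
  by have := Bop_linear T (-1) 0 0; rewrite !scaleN1r oppr0 addr0 addNr.
by have := Bop_linear T c (S f) 0; rewrite T0 !addr0.
Qed.

Lemma bop_adjoint_comp T S :
  bop_adjoint (bop_comp T S) = bop_comp (bop_adjoint S) (bop_adjoint T).
Proof. by apply: bop_adjoint_eq => f h; rewrite /= !bop_adjointP. Qed.

Lemma bop_comp_norm T S : `|bop_comp T S| <= `|T| * `|S|.
Proof. by rewrite !bop_normE -rmorphM lecR opnorm_comp. Qed.

Lemma bop_cstar_identity T : `|bop_comp (bop_adjoint T) T| = `|T| ^+ 2.
Proof. by rewrite !bop_normE -rmorphXn opnorm_star_comp. Qed.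

HB.instance Definition _ := isCStarAlgebra.Build R (Bop X)
  bop_compA bop_compDl bop_compDr bop_compZl bop_compZr bop_adjointK
  bop_adjointD bop_adjointZ bop_adjoint_comp bop_comp_norm bop_cstar_identity.

End OperatorAlgebra.

(** * Substitution operators *)

Section Substitution.
Context (R : realType).
Local Notation mu := (counting_measure R).
Local Notation abs2 c := (Normc.normc c ^+ 2).

(** For nonnegative functions this is the reindexing of unordered sums; positive
    and negative parts give the general case. *)
Lemma int_counting_reindex (A B : set R) (phi : R -> R) (u : R -> R) :
  set_bij A B phi ->
  (\int[mu]_(z in A) (u (phi z))%:E = \int[mu]_(z in B) (u z)%:E)%E.
Proof.
move=> AB.
have reindex_ge0 v : (forall z, 0 <= v z) ->
    (\int[mu]_(z in A) (v (phi z))%:E = \int[mu]_(z in B) (v z)%:E)%E.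
  by move=> v0; rewrite !int_counting_esum// (@reindex_esum _ _ _ _ _ _ (fun z => (v z)%:E) AB).
rewrite integralE [RHS]integralE; congr (_ - _)%E.
  transitivity (\int[mu]_(z in A) (Num.max (u (phi z)) 0)%:E)%E.
    by apply: eq_integral => z _; rewrite funeposE EFin_max.
  rewrite (reindex_ge0 (fun z => Num.max (u z) 0)); last first.
    by move=> z; rewrite le_max lexx orbT.
  by apply: eq_integral => z _; rewrite funeposE EFin_max.
transitivity (\int[mu]_(z in A) (Num.max (- u (phi z)) 0)%:E)%E.
  by apply: eq_integral => z _; rewrite funenegE EFin_max.
rewrite (reindex_ge0 (fun z => Num.max (- u z) 0)); last first.
  by move=> z; rewrite le_max lexx orbT.
by apply: eq_integral => z _; rewrite funenegE EFin_max.
Qed.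

Lemma int_subset_indic (X A : set R) (u v : R -> R) : A `<=` X ->
  (forall z, A z -> u z = v z) -> (forall z, ~ A z -> u z = 0) ->
  (\int[mu]_(z in X) (u z)%:E = \int[mu]_(z in A) (v z)%:E)%E.
Proof.
move=> AX uv u0; rewrite -[in RHS](setIidr AX) integral_mkcondr.
apply: eq_integral => z _; rewrite patchE.
by have [Az|nAz] := pselect (A z); [rewrite mem_set// uv|rewrite memNset// u0].
Qed.

Section OneSubstitution.
Context (X A B : set R) (phi psi : R -> R).
Hypothesis (AX : A `<=` X) (BX : B `<=` X).
Hypothesis phiP : forall z, A z -> B (phi z) /\ psi (phi z) = z.
Hypothesis psiP : forall y, B y -> A (psi y) /\ phi (psi y) = y.

Definition substitution (f : R -> R[i]) : R -> R[i] :=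
  fun z => \1_A z * f (phi z).

Lemma substitution_in f z : A z -> substitution f z = f (phi z).
Proof. by move=> Az; rewrite /substitution indicE mem_set// mul1r. Qed.

Lemma substitution_out f z : ~ A z -> substitution f z = 0.
Proof. by move=> Az; rewrite /substitution indicE memNset// mul0r. Qed.

Lemma substitution_bij : set_bij A B phi.
Proof.
split.
- by move=> z /phiP[].
- move=> z w /set_mem/phiP[_ zK] /set_mem/phiP[_ wK] zw.
  by rewrite -zK -wK zw.
- by move=> y /psiP[Ay yK]; exists (psi y).
Qed.

Lemma int_substitution_abs2 (f : R -> R[i]) :
  (\int[mu]_(z in X) (abs2 (substitution f z))%:E =
   \int[mu]_(z in B) (abs2 (f z))%:E)%E.
Proof.
rewrite -(int_counting_reindex (fun z => abs2 (f z)) substitution_bij).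
apply: int_subset_indic AX _ _ => z Az; first by rewrite substitution_in.
by rewrite substitution_out// Normc.normc0 expr0n.
Qed.

Lemma int_subset_abs2 (f : R -> R[i]) :
  (\int[mu]_(z in B) (abs2 (f z))%:E <= \int[mu]_(z in X) (abs2 (f z))%:E)%E.
Proof.
by apply: ge0_subset_integral => // z _; rewrite lee_fin sqr_ge0.
Qed.

Lemma substitution_L2 (f : L2 X) :
  substitution f \in square_integrable_pred X.
Proof.
have := L2P f; rewrite !inE => -[_ finf]; split.
  by move=> z Xz; rewrite substitution_out// => /AX.
by rewrite int_substitution_abs2; exact: le_lt_trans (int_subset_abs2 f) finf.
Qed.

Definition L2substitution (f : L2 X) : L2 X := MkL2 (substitution_L2 f).

Lemma L2substitution_bounded : bounded_by L2substitution 1.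
Proof.
split=> // f; rewrite mul1r /L2norm ler_wsqrtr//.
have := L2P f; rewrite inE => -[_ finf].
have int_ge0 (C : set R) h : (0 <= \int[mu]_(z in C) (abs2 (h z : R[i]))%:E)%E.
  by apply: integral_ge0 => z _; rewrite lee_fin sqr_ge0.
rewrite /Rintegral fine_le ?int_substitution_abs2 ?int_subset_abs2//.
  rewrite ge0_fin_numE//; exact: le_lt_trans (int_subset_abs2 f) finf.
by rewrite ge0_fin_numE.
Qed.

End OneSubstitution.

Lemma substitution_adjoint (X A B : set R) (phi psi : R -> R)
  (AX : A `<=` X) (BX : B `<=` X)
  (phiP : forall z, A z -> B (phi z) /\ psi (phi z) = z)
  (psiP : forall y, B y -> A (psi y) /\ phi (psi y) = y) :
  adjoint_to (L2substitution AX BX phiP psiP) (L2substitution BX AX psiP phiP).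
Proof.
move=> f h.
have part (p : R[i] -> R) : p 0 = 0 ->
   \int[mu]_(z in X) p (substitution A phi f z * conjc (h z)) =
   \int[mu]_(z in X) p (f z * conjc (substitution B psi h z)).
  move=> p0; congr fine.
  transitivity (\int[mu]_(z in A) (p (f (phi z) * conjc (h (psi (phi z)))))%:E)%E.
    apply: int_subset_indic AX _ _ => z Az.
      by rewrite substitution_in// (phiP _ Az).2.
    by rewrite substitution_out// mul0r.
  rewrite (int_counting_reindex (fun z => p (f z * conjc (h (psi z))))
    (substitution_bij phiP psiP)).
  apply/esym; apply: int_subset_indic BX _ _ => z Bz.
    by rewrite substitution_in.
  by rewrite substitution_out// conjc0 mulr0.
by rewrite /L2dot; congr Complex; exact: part.
Qed.

(** A bijection [phi] between two subsets [A] and [B] of [X], with inverse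
    [psi], induces a partial isometry of [L2 X], whose adjoint is induced by
    [psi]: this is the change of variables formula for unordered sums. *)
Lemma substitution_operator (X A B : set R) (phi psi : R -> R) :
  A `<=` X -> B `<=` X ->
  (forall z, A z -> B (phi z) /\ psi (phi z) = z) ->
  (forall y, B y -> A (psi y) /\ phi (psi y) = y) ->
  exists T : Bop X,
    (forall f : L2 X, L2fun (T f) = (fun z => \1_A z * f (phi z))) /\
    (forall f : L2 X, L2fun (star T f) = (fun z => \1_B z * f (psi z))).
Proof.
move=> AX BX phiP psiP.
have TP : L2substitution AX BX phiP psiP \in @bounded_adjointable_pred R X.
  rewrite inE; split; first by exists 1; exact: L2substitution_bounded.
  by exists (L2substitution BX AX psiP phiP); exact: substitution_adjoint.
exists (MkBop TP); split=> f //.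
have -> // : bopfun (star (MkBop TP)) = L2substitution BX AX psiP phiP.
exact: adjoint_unique (bop_adjointP (MkBop TP)) (substitution_adjoint _ _ _ _).
Qed.

End Substitution.

(** * Orbits of a Markov interval map that escape *)

Section Dynamics.
Context (R : realType) (a b : R) (g : markov_map a b).
Local Notation n := (gaps_nb g).
Implicit Types (i j : 'I_n.+1) (x y z w : R) (k m : nat).

Lemma pieceE i z : piece i z <-> lft i <= z <= rgt i.
Proof. by rewrite /piece /= in_itv. Qed.

Lemma piece_lft i : piece i (lft i).
Proof. by apply/pieceE; rewrite lexx ltW// lft_lt_rgt. Qed.

Lemma piece_rgt i : piece i (rgt i).
Proof. by apply/pieceE; rewrite lexx ltW// lft_lt_rgt. Qed.

Lemma rgt_le_lft_lt i j : (i < j)%N -> rgt i <= lft j.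
Proof.
case: j => j; elim: j => [//|j IHj] jn /=.
rewrite ltnS leq_eqVlt => /orP[/eqP ij|ij]; first by apply: rgt_le_lft; rewrite /= ij.
have jn' := ltnW jn; apply: le_trans (IHj jn' ij) _.
apply: le_trans (ltW (lft_lt_rgt (Ordinal jn'))) _.
exact: rgt_le_lft.
Qed.

Lemma lft_le i j : (i <= j)%N -> lft i <= lft j.
Proof.
rewrite leq_eqVlt => /orP[/eqP/val_inj->//|/rgt_le_lft_lt].
exact: le_trans (ltW (lft_lt_rgt i)).
Qed.

Lemma rgt_le i j : (i <= j)%N -> rgt i <= rgt j.
Proof.
rewrite leq_eqVlt => /orP[/eqP/val_inj->//|/rgt_le_lft_lt ij].
exact: le_trans ij (ltW (lft_lt_rgt j)).
Qed.

Lemma piece_sub_itv i : piece i `<=` `[a, b]%classic.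
Proof.
have ai : a <= lft i by have := @lft_le ord0 i (leq0n i); rewrite lft_first.
have ib : rgt i <= b by have := @rgt_le i ord_max (leq_ord i); rewrite rgt_last.
move=> z /pieceE/andP[lz zr]; rewrite /= in_itv /=.
by rewrite (le_trans ai lz) (le_trans zr ib).
Qed.

Lemma piece_meet i j z : piece i z -> piece j z -> i != j ->
  z = lft i \/ z = rgt i.
Proof.
move=> /pieceE/andP[liz zri] /pieceE/andP[ljz zrj]; rewrite neq_ltn => /orP[ij|ji].
  by right; apply/eqP; rewrite eq_le zri (le_trans (rgt_le_lft_lt ij)).
by left; apply/eqP; rewrite eq_le liz andbT (le_trans zrj)// rgt_le_lft_lt.
Qed.

Lemma endpoint_lft i : endpoints g (lft i). Proof. by left; exists i. Qed.
Lemma endpoint_rgt i : endpoints g (rgt i). Proof. by right; exists i. Qed.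

Lemma piece_unique i j z :
  ~ endpoints g z -> piece i z -> piece j z -> i = j.
Proof.
move=> nz iz jz; apply/eqP; apply: contra_notT nz => ij.
by case: (piece_meet iz jz ij) => ->; [exact: endpoint_lft|exact: endpoint_rgt].
Qed.

Lemma endpoint_piece i z : endpoints g z -> piece i z -> z = lft i \/ z = rgt i.
Proof.
move=> gz iz; suff [j [jz zj]] : exists j, piece j z /\ (z = lft j \/ z = rgt j).
  by have [->//|ij] := eqVneq i j; exact: piece_meet iz jz ij.
by case: gz => -[j _ <-]; exists j; split;
  (exact: piece_lft || exact: piece_rgt || auto).
Qed.

Lemma endpoint_mdom z : endpoints g z -> mdom g z.
Proof. by case=> -[j _ <-]; exists j => //; [exact: piece_lft|exact: piece_rgt]. Qed.

(** Endpoints are mapped to endpoints, also by the branch of a neighbouring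
    interval, because a point shared by two intervals is an endpoint of both.
    Hence an orbit that leaves the domain never visits an endpoint. *)
Lemma endpoint_branch i z :
  endpoints g z -> piece i z -> endpoints g (branch i z).
Proof.
by move=> gz /(endpoint_piece gz)[->|->]; have [] := branch_endpoints i.
Qed.

Lemma endpoint_iterate k z w : iterate g k z w -> endpoints g z -> endpoints g w.
Proof.
elim: k z => [z <-//|k IHk z [i iz zw] gz].
exact: IHk zw (endpoint_branch gz iz).
Qed.

Lemma escape_not_endpoint k z w :
  iterate g k z w -> ~ mdom g w -> ~ endpoints g z.
Proof. by move=> zw nw /(endpoint_iterate zw)/endpoint_mdom. Qed.

Lemma gap_not_mdom w : gaps g w -> ~ mdom g w.
Proof.
move=> [k _ kw] [j _ /pieceE/andP[ljw wrj]].
move: kw; rewrite /gap /= in_itv /= => /andP[rw wl].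
have [jk|kj] := leqP j k.
  have := lt_le_trans rw wrj; apply/negP; rewrite -leNgt.
  exact: (@rgt_le j (widen_ord (leqnSn n) k)).
have := le_lt_trans ljw wl; apply/negP; rewrite -leNgt.
exact: (@lft_le (lift ord0 k) j).
Qed.

Lemma iterate_trans k m z y w :
  iterate g k z y -> iterate g m y w -> iterate g (k + m) z w.
Proof.
by elim: k z => [z ->//|k IHk z [i iz zy] yw]; exists i => //; exact: IHk zy yw.
Qed.

(** An orbit that escapes avoids the endpoints of the intervals, where alone
    the map has two values, so that all orbits of its first point are initial
    segments of it. *)
Lemma escape_itinerary k m z y w :
  iterate g k z w -> ~ mdom g w -> iterate g m z y ->
  (m <= k)%N /\ iterate g (k - m) y w.
Proof.
elim: m k z => [k z zw nw <-|m IHm k z zw nw [i iz zy]]; first by rewrite subn0.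
have nz := escape_not_endpoint zw nw.
case: k zw => [zw|k [j jz zw]]; first by case: nw; rewrite -zw; exists i.
rewrite ltnS subSS; rewrite -(piece_unique nz iz jz) in zw.
exact: IHm zw nw zy.
Qed.

Lemma escape_unique k m z w y :
  iterate g k z w -> ~ mdom g w -> iterate g m z y -> ~ mdom g y ->
  k = m /\ w = y.
Proof.
move=> zw nw zy ny; have [mk yw] := escape_itinerary zw nw zy.
have [km _] := escape_itinerary zy ny zw.
have {mk km}km : k = m by apply/eqP; rewrite eqn_leq km mk.
by move: yw; rewrite km subnn => ->.
Qed.

Section EscapePoint.
Context (x : R).
Hypothesis escape_x : escape_set g x.
Local Notation e := (esc_point g x).
Local Notation X := (backward_orbit g x).

Lemma esc_point_spec : gaps g e /\ exists k, iterate g k x e.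
Proof.
have [k k0 [w xw gw]] := escape_x; have nw := gap_not_mdom gw.
have tau_exits : exits g x (esc_time g x).
  rewrite /esc_time; case: xgetP => [m _ []//|/(_ k)[]].
  split=> //; first by exists w.
  by move=> m _ [y xy ny]; have [-> _] := escape_unique xw nw xy ny.
have [xe ne] : iterate g (esc_time g x) x e /\ ~ mdom g e.
  rewrite /esc_point; case: xgetP => [y -> []//|noy].
  by have [y xy ny] := tau_exits; case: (noy y).
have [_ we] := escape_unique xw nw xe ne.
by rewrite -we; split=> //; exists k.
Qed.

Lemma esc_point_not_mdom : ~ mdom g e.
Proof. by have [ge _] := esc_point_spec; exact: gap_not_mdom. Qed.

(** If [g^k y = g^m x], then [g^m x] lies on the way from [x] to the escape
    point, which [y] therefore reaches as well. *)
Lemma backward_orbit_gorbit : X = gorbit g x.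
Proof.
have [_ [t xe]] := esc_point_spec.
apply/seteqP; split=> y [aby].
  by move=> [k ye]; split=> //; exists k, t, e.
move=> [k [m [w [yw xw]]]]; split=> //.
have [_ we] := escape_itinerary xe esc_point_not_mdom xw.
by exists (k + (t - m))%N; exact: iterate_trans yw we.
Qed.

Lemma backward_orbit_not_endpoint y : X y -> ~ endpoints g y.
Proof. by move=> [_ [k ye]]; exact: escape_not_endpoint ye esc_point_not_mdom. Qed.

Lemma backward_orbit_pre i z : piece i z -> X (branch i z) -> X z.
Proof.
move=> iz [_ [k ze]]; split; first exact: piece_sub_itv iz.
by exists k.+1, i.
Qed.

End EscapePoint.

Lemma branch_inj i : {in piece i &, injective (branch i)}.
Proof.
suff inj_lt y z : piece i y -> piece i z -> y < z -> branch i y <> branch i z.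
  move=> y z /set_mem yi /set_mem zi yz; case: (ltgtP y z) => // lt.
    by case: (inj_lt y z yi zi lt).
  by case: (inj_lt z y zi yi lt).
move=> iy iz yz e; case: (branch_monotone i) => mono.
  by have := mono y z iy iz yz; rewrite e ltxx.
by have := mono z y iz iy yz; rewrite e ltxx.
Qed.

Lemma interior_piece i z : (piece i)° z <-> lft i < z < rgt i.
Proof. by rewrite /piece interior_itv_bnd /= in_itv. Qed.

Lemma interior_piece_endpoint i z : (piece i)° z <-> piece i z /\ ~ endpoints g z.
Proof.
split=> [/interior_piece/andP[lz zr]|[iz nz]]; last first.
  move/pieceE: (iz) => /andP[]; rewrite le_eqVlt => /orP[/eqP zl|lz].
    by case: nz; rewrite -zl; exact: endpoint_lft.
  rewrite le_eqVlt => /orP[/eqP zr|zr].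
    by case: nz; rewrite zr; exact: endpoint_rgt.
  by apply/interior_piece; rewrite lz.
have iz : piece i z by apply/pieceE; rewrite !ltW.
by split=> // gz; case: (endpoint_piece gz iz) lz zr => ->; rewrite ltxx.
Qed.

(** The image of an interval meets the domain in a union of intervals: it
    contains an interval of the partition, endpoints included, as soon as it
    contains a point that belongs to no other interval. *)
Lemma branch_image_piece i j w : (piece j)° w ->
  (branch i @` piece i) w -> piece j `<=` branch i @` piece i.
Proof.
move=> jw iw z jz; have [jw' nw] := (interior_piece_endpoint j w).1 jw.
have [J _ imE] := branch_markov i.
have : (\bigcup_(l in J) piece l) w by rewrite -imE; split=> //; exists j.
move=> [l Jl lw]; have jl := piece_unique nw lw jw'.
have : (\bigcup_(l in J) piece l) z by exists j => //; rewrite -jl.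
by rewrite -imE => -[].
Qed.

Lemma transition_image i j :
  transition_matrix g i j = 1%N -> piece j `<=` branch i @` piece i.
Proof.
rewrite mxE; case: asboolP => // ij _.
pose c := (lft j + rgt j) / 2.
have jc : (piece j)° c.
  by apply/interior_piece; have := lft_lt_rgt j; rewrite /c; lra.
apply: (branch_image_piece jc); have [y iy yc] := ij _ jc.
by exists y => //; have [] := (interior_piece_endpoint i y).1 iy.
Qed.

(** A transition is witnessed by a single point mapped into the interior. *)
Lemma transition_point i j z : piece i z -> (piece j)° (branch i z) ->
  transition_matrix g i j = 1%N.
Proof.
move=> iz jz; rewrite mxE; case: asboolP => // -[] w jw.
have [jw' nw] := (interior_piece_endpoint j w).1 jw.
have /(_ w jw')[y iy yw] : piece j `<=` branch i @` piece i.
  by apply: (branch_image_piece jz); exists z.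
exists y => //; apply/interior_piece_endpoint; split=> // gy.
by apply: nw; rewrite -yw; exact: endpoint_branch.
Qed.

End Dynamics.

(** * Representations of a C*-algebra and morphisms into the operators *)

Section Representations.
Context (R : realType).

(** [<T^* k, |y>> = <k, T |y>>], so the values on the basis determine the
    adjoint at every point. *)
Lemma Bop_eq_ket (X : set R) (T S : Bop X) :
  (forall y : X, T (ket y) = S (ket y)) -> T = S.
Proof.
move=> TS; rewrite -(bop_adjointK T) -(bop_adjointK S); congr bop_adjoint.
apply: Bop_eqP => k; apply: L2_eqP => z Xz.
rewrite -!(L2dot_ket _ (SigSub (mem_set Xz))).
by rewrite !(adjoint_sym (bop_adjointP _)) TS.
Qed.

Lemma star_morphism0 (A B : cstarAlgType R) (F : A -> B) :
  star_morphism F -> F 0 = 0.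
Proof.
by case=> F_lin _ _; have := F_lin (-1) 0 0; rewrite !scaleN1r oppr0 addr0 addNr.
Qed.

Lemma star_morphismD (A B : cstarAlgType R) (F : A -> B) :
  star_morphism F -> {morph F : c d / c + d}.
Proof. by case=> F_lin _ _ c d; have := F_lin 1 c d; rewrite !scale1r. Qed.

Lemma star_morphismB (A B : cstarAlgType R) (F : A -> B) :
  star_morphism F -> {morph F : c d / c - d}.
Proof.
case=> F_lin _ _ c d; have := F_lin (-1) d c.
by rewrite !scaleN1r => Fdc; rewrite addrC Fdc addrC.
Qed.

Lemma star_morphism_family (G : graph) (V : {set vertex G})
    (A B : cstarAlgType R) (s : edge G -> A) (p : vertex G -> A) (F : A -> B) :
  star_morphism F -> relative_family V s p ->
  relative_family V (F \o s) (F \o p).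
Proof.
move=> FM [s_pi p_proj p_orth s_rng s_src p_sum].
have [_ FMul FStar] := FM.
split=> /=.
- by move=> e; rewrite -FStar -!FMul s_pi.
- by move=> v; rewrite -FStar -FMul; have [-> ->] := p_proj v.
- by move=> v w vw; rewrite -FMul p_orth// star_morphism0.
- by move=> e; rewrite -FStar -FMul s_rng.
- move=> e; have [c sc] := s_src e; exists (F c).
  by rewrite -!FStar -!FMul -star_morphismB// sc.
- move=> v vV ve; rewrite p_sum//.
  rewrite (big_morph F (star_morphismD FM) (star_morphism0 FM)).
  by apply: eq_bigr => e _; rewrite -FStar -FMul.
Qed.

Lemma morphism_representation (A : cstarAlgType R) (X : set R)
    (F : A -> Bop X) :
  star_morphism F -> is_representation (fun c f => F c f).
Proof.
case=> F_lin FMul FStar; split.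
- by move=> c; exact: Bop_linear.
- by move=> c; exists (opnorm (F c)) => f; exact: opnormP.
- by move=> t c d f; rewrite F_lin.
- by move=> c d f; rewrite FMul.
- by move=> c f h; rewrite FStar (adjoint_sym (bop_adjointP _)).
Qed.

(** The adjoint of [rho c] is [rho (star c)], so [rho] takes its values in the
    adjointable bounded operators. *)
Lemma representation_morphism (A : cstarAlgType R) (X : set R)
    (rho : A -> L2 X -> L2 X) : is_representation rho ->
  exists2 F : A -> Bop X, star_morphism F & forall c f, F c f = rho c f.
Proof.
move=> [_ rho_bd rho_lin rho_mul rho_star].
have adj c : adjoint_to (rho c) (rho (star c)).
  by move=> f h; rewrite -{1}(starK c) rho_star.
have rhoP c : rho c \in @bounded_adjointable_pred R X.
  rewrite inE; split; last by exists (rho (star c)).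
  have [M cM] := rho_bd c; exists `|M|; split=> // f.
  by rewrite (le_trans (cM f))// ler_wpM2r ?L2norm_ge0 ?ler_norm.
exists (fun c => MkBop (rhoP c)) => //; split.
- by move=> t c d; apply: Bop_eqP => f; exact: rho_lin.
- by move=> c d; apply: Bop_eqP => f; exact: rho_mul.
- move=> c; apply/esym; apply: bop_adjoint_eq; exact: adj.
Qed.

(** Agreement on the basis is agreement of the generators, and the uniqueness
    part of the universal property extends it to the algebra. *)
Lemma representation_unique (G : graph) (V : {set vertex G})
    (A : cstarAlgType R) (s : edge G -> A) (p : vertex G -> A) (X : set R)
    (rho sigma : A -> L2 X -> L2 X) :
  is_relative_graph_algebra V s p ->
  is_representation rho -> is_representation sigma ->
  (forall e (y : X), rho (s e) (ket y) = sigma (s e) (ket y)) ->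
  (forall v (y : X), rho (p v) (ket y) = sigma (p v) (ket y)) ->
  forall c f, rho c f = sigma c f.
Proof.
move=> [sp univ] /representation_morphism[F FM FE].
move=> /representation_morphism[F' FM' FE'] eq_s eq_p c f.
have [H [_ uniqH]] := univ _ _ _ (star_morphism_family FM sp).
have <- : F c f = rho c f by exact: FE.
have <- : F' c f = sigma c f by exact: FE'.
rewrite -(uniqH F); last by split.
rewrite -(uniqH F') //; split=> // [e|v]; apply: Bop_eq_ket => y.
  by rewrite /= FE FE' eq_s.
by rewrite /= FE FE' eq_p.
Qed.

(** The unitary that identifies the two spaces once the two sets are known to be
    equal. *)
Definition castL2 (X Y : set R) (XY : X = Y) (f : L2 X) : L2 Y :=
  eq_rect X (fun Z => L2 Z) f Y XY.

Lemma castL2E (X Y : set R) (XY : X = Y) (f : L2 X) :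
  castL2 XY f = f :> (R -> R[i]).
Proof. by case: Y / XY. Qed.

Lemma castL2K (X Y : set R) (XY : X = Y) (f : L2 Y) :
  castL2 XY (castL2 (esym XY) f) = f.
Proof. by case: Y / XY f. Qed.

Lemma castL2_unitary (X Y : set R) (XY : X = Y) : is_L2_unitary (castL2 XY).
Proof. by case: Y / XY; split=> // h; exists h. Qed.

Lemma castL2_ket (X Y : set R) (XY : X = Y) (y : X) (y' : Y) :
  val y = val y' -> castL2 XY (ket y) = ket y'.
Proof. by move=> yy'; apply/val_inj; rewrite /= castL2E /= yy'. Qed.

Lemma castL2_representation (A : cstarAlgType R) (X Y : set R) (XY : X = Y)
    (rho : A -> L2 X -> L2 X) : is_representation rho ->
  is_representation (fun c h => castL2 XY (rho c (castL2 (esym XY) h))).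
Proof. by case: Y / XY. Qed.

End Representations.

(** * The branching system on the escaping orbit *)

Section BranchingSystem.
Context (R : realType) (a b : R) (g : markov_map a b) (x : R).
Hypothesis escape_x : escape_set g x.
Local Notation X := (backward_orbit g x).
Local Notation vtx := (vertex (markov_graph g)).
Local Notation edg := (edge (markov_graph g)).
Implicit Types (e : edg) (i j : vtx) (y z : R).

Lemma branch_invK i z : piece i z -> branch_inv i (branch i z) = z.
Proof. by move=> iz; apply: pinvKV (mem_set iz); exact: branch_inj. Qed.

Lemma branch_invP e y : piece (rng e) y ->
  piece (src e) (branch_inv (src e) y) /\
  branch (src e) (branch_inv (src e) y) = y.
Proof.
move=> /(transition_image (eqP (valP e)))[z iz <-].
by rewrite branch_invK.
Qed.

Lemma bs_f_inj e : {in bs_D x (rng e) &, injective (bs_f e)}.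
Proof.
move=> y z /set_mem[jy _] /set_mem[jz _] yz.
by rewrite -(branch_invP jy).2 -(branch_invP jz).2; congr branch.
Qed.

Lemma bs_fK e y : bs_D x (rng e) y -> bs_finv x e (bs_f e y) = y.
Proof. by move=> jy; apply: pinvKV (mem_set jy); exact: bs_f_inj. Qed.

Lemma bs_fP e y : bs_D x (rng e) y ->
  bs_R x e (bs_f e y) /\ bs_finv x e (bs_f e y) = y.
Proof.
move=> jy; split; last exact: bs_fK.
by have [iy yK] := branch_invP jy.1; split=> //=; rewrite /bs_f yK.
Qed.

Lemma bs_finvP e z : bs_R x e z ->
  bs_D x (rng e) (bs_finv x e z) /\ bs_f e (bs_finv x e z) = z.
Proof.
move=> [iz jz]; have zE : bs_f e (branch (src e) z) = z by exact: branch_invK.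
by rewrite -zE bs_fK.
Qed.

Lemma bs_D_sub i : bs_D x i `<=` X. Proof. by move=> z []. Qed.

Lemma bs_R_sub_D e : bs_R x e `<=` bs_D x (src e).
Proof. by move=> z [iz [_ Xz]]; split=> //; exact: backward_orbit_pre iz Xz. Qed.

Lemma bs_R_sub e : bs_R x e `<=` X.
Proof. by move=> z /bs_R_sub_D[]. Qed.

Lemma bs_D_disjoint i j z : bs_D x i z -> bs_D x j z -> i = j.
Proof.
move=> [iz Xz] [jz _]; apply: piece_unique iz jz.
exact: backward_orbit_not_endpoint escape_x _ Xz.
Qed.

Lemma bs_R_disjoint e e' z : bs_R x e z -> bs_R x e' z -> e = e'.
Proof.
move=> ez e'z; have src_ee' : src e = src e'.
  by apply: (@bs_D_disjoint _ _ z); exact: bs_R_sub_D.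
move: ez e'z => [_ ez] [_ e'z]; rewrite -src_ee' in e'z.
have rng_ee' : rng e = rng e' by exact: bs_D_disjoint ez e'z.
by apply: val_inj; apply/eqP; rewrite -pair_eqE; apply/andP; split; apply/eqP.
Qed.

(** A point of [X] in the interval [i] is mapped either to the escape point or
    into another interval [j].  The first case would make the entry of the
    escape matrix equal to 1; in the second one [i -> j] is an edge. *)
Lemma bs_D_cover i z : escape_matrix (inl i) (esc_symbol g x) = 0%N ->
  bs_D x i z -> exists2 e, src e = i & bs_R x e z.
Proof.
move=> i_esc [iz Xz]; have nz := backward_orbit_not_endpoint escape_x Xz.
have ne := esc_point_not_mdom escape_x.
move: (Xz) => [_ [[|k] ze]].
  by case: ne; rewrite -ze; exists i.
move: ze => [i' i'z ze]; rewrite -(piece_unique nz iz i'z) in ze.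
have Xgz : X (branch i z).
  split; last by exists k.
  by rewrite -(branch_image g); exists i => //; exists z.
have ngz := backward_orbit_not_endpoint escape_x Xgz.
case: k ze => [ze|k [j jgz _]].
  have [[k _ ke] _] := esc_point_spec escape_x.
  have gk : `[< gap k !=set0 >] by apply/asboolP; exists (esc_point g x).
  have [l symE le] : exists2 l, esc_symbol g x = inr l &
      gap (val l) (esc_point g x).
    rewrite /esc_symbol; case: xgetP => [u -> [l -> le]|noP]; first by exists l.
    by case: (noP (inr (exist _ k gk))); exists (exist _ k gk).
  move: i_esc; rewrite symE /=; case: asboolP => // -[].
  exists z; split; first exact/interior_piece_endpoint.
  by exists (esc_point g x) => //; exists i.
have ij : transition_matrix g i j == 1%N.
  by apply/eqP/(transition_point iz)/interior_piece_endpoint.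
by exists (exist _ (i, j) ij).
Qed.

(** The operator of the branching system and the operator [S_ij] agree on the
    basis, because the branch and its inverse are mutually inverse bijections
    between [bs_R x e] and [bs_D x (rng e)]. *)
Lemma bs_ket e y : X y ->
  (fun z => \1_(bs_R x e) z * (\1_[set y] : R -> R[i]) (bs_finv x e z)) =
  (\1_(piece (rng e)) y : R[i]) *: (\1_[set branch_inv (src e) y] : R -> R[i]).
Proof.
move=> Xy; apply/funext => z.
rewrite [RHS](_ : _ = \1_(piece (rng e)) y * \1_[set branch_inv (src e) y] z)//.
have [jy|njy] := pselect (piece (rng e) y); last first.
  rewrite [in RHS]indicE memNset// mul0r.
  have [ez|nez] := pselect (bs_R x e z); last by rewrite indicE memNset// mul0r.
  rewrite [X in _ * X]indicE memNset ?mulr0//= => zy.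
  by have [[jz _] _] := bs_finvP ez; rewrite zy in jz.
have [yR yK] : bs_R x e (bs_f e y) /\ bs_finv x e (bs_f e y) = y by exact: bs_fP.
have [->|zy] := eqVneq z (bs_f e y).
  by rewrite yK !indicE !mem_set.
rewrite [X in _ = _ * X]indicE memNset ?mulr0//=; last by apply/eqP.
have [ez|nez] := pselect (bs_R x e z); last by rewrite indicE memNset// mul0r.
rewrite [X in _ * X]indicE memNset ?mulr0//= => zE.
by case/eqP: zy; rewrite -zE; have [_ ->] := bs_finvP ez.
Qed.

Section Operators.
Context (V : {set vtx}).
Hypothesis escape_V : forall i, i \in V ->
  escape_matrix (inl i) (esc_symbol g x) = 0%N.

(** The operators of the branching system satisfy the relations of the relative
    graph algebra.  The products [t e (t e)^*] and [(t e)^* t e] are the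
    projections on the sets [bs_R x e] and [bs_D x (rng e)], so that the
    relations express inclusions and disjointness between these sets; the sum
    relation at [v] in [V] is the covering of [bs_D x v] by the sets
    [bs_R x e]. *)
Lemma bs_operators :
  exists (t : edg -> Bop X) (q : vtx -> Bop X),
  [/\ relative_family V t q,
      forall e (f : L2 X),
        L2fun (t e f) = (fun z => \1_(bs_R x e) z * f (bs_finv x e z)) &
      forall i (f : L2 X), L2fun (q i f) = (fun z => \1_(bs_D x i) z * f z)].
Proof.
have id_op (A : set R) : A `<=` X -> exists T : Bop X,
    (forall f : L2 X, L2fun (T f) = (fun z => \1_A z * f z)) /\
    (forall f : L2 X, L2fun (star T f) = (fun z => \1_A z * f z)).
  by move=> AX; apply: (substitution_operator (phi := id) (psi := id) AX AX).
have [t tP] := choice (fun e =>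
  substitution_operator (@bs_R_sub e) (@bs_D_sub _) (@bs_finvP e) (@bs_fP e)).
have [q qP] := choice (fun i => id_op _ (@bs_D_sub i)).
exists t, q; split; last first.
- by move=> i f; have [-> _] := qP i.
- by move=> e f; have [-> _] := tP e.
have tE e f z : t e f z = \1_(bs_R x e) z * f (bs_finv x e z).
  by have [-> _] := tP e.
have tsE e f z : star (t e) f z = \1_(bs_D x (rng e)) z * f (bs_f e z).
  by have [_ ->] := tP e.
have qE i f z : q i f z = \1_(bs_D x i) z * f z by have [-> _] := qP i.
have qsE i f z : star (q i) f z = \1_(bs_D x i) z * f z by have [_ ->] := qP i.
have ttE e f z : cmul (t e) (star (t e)) f z = \1_(bs_R x e) z * f z.
  rewrite tE tsE; have [ez|nez] := pselect (bs_R x e z).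
    have [jz zE] := bs_finvP ez.
    by rewrite zE [X in _ * (X * _)]indicE mem_set// mul1r.
  by rewrite indicE memNset// !mul0r.
have indicM (A : set R) (c : R[i]) z : \1_A z * (\1_A z * c) = \1_A z * c.
  by rewrite indicE; case: (_ \in _); rewrite ?mul1r ?mul0r.
split.
- by move=> e; apply: Bop_eqP => f; apply: L2_eqP => z _; rewrite ttE tE indicM.
- move=> i; split; apply: Bop_eqP => f; apply: L2_eqP => z _.
    by rewrite !qE indicM.
  by rewrite qE qsE.
- move=> i j ij; apply: Bop_eqP => f; apply: L2_eqP => z _.
  rewrite qE qE !indicE; have [iz|niz] := pselect (bs_D x i z); last first.
    by rewrite memNset// mul0r.
  rewrite [z \in bs_D x j]memNset ?mul0r ?mulr0// => jz.
  by move: ij; rewrite (bs_D_disjoint iz jz) eqxx.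
- move=> e; apply: Bop_eqP => f; apply: L2_eqP => z _.
  rewrite tsE tE qE; have [jz|njz] := pselect (bs_D x (rng e) z); last first.
    by rewrite indicE memNset// !mul0r.
  have [ez zE] := bs_fP jz.
  by rewrite zE [X in _ * (X * _)]indicE mem_set// mul1r.
- move=> e; have [|T [TE TsE]] := id_op (bs_D x (src e) `\` bs_R x e).
    by move=> z [[]].
  exists T; apply: Bop_eqP => f; apply: L2_eqP => z _.
  rewrite -[RHS]/(star T (T f) z) TsE TE Bop_subE L2_subE qE ttE indicM -mulrBl !indicE.
  have [ez|nez] := pselect (bs_R x e z).
    rewrite (mem_set ez) (mem_set (bs_R_sub_D ez)) subrr memNset//.
    by case.
  rewrite (memNset nez) subr0.
  have [iz|niz] := pselect (bs_D x (src e) z); first by rewrite !mem_set.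
  by rewrite !memNset// => -[].
- move=> i iV _; apply: Bop_eqP => f; apply: L2_eqP => z _.
  have sumE (P : pred edg) :
      (\sum_(e | P e) cmul (t e) (star (t e))) f z =
      \sum_(e | P e) \1_(bs_R x e) z * f z.
    rewrite -(eq_bigr _ (fun e _ => ttE e f z)).
    by apply: (big_morph (fun T : Bop X => T f z)).
  rewrite sumE qE; have [iz|niz] := pselect (bs_D x i z).
    have [e src_e ez] := bs_D_cover (escape_V iV) iz.
    rewrite (bigD1 e) ?src_e//= big1 ?addr0; last first.
      move=> e' /andP[_ ee']; rewrite indicE memNset ?mul0r// => e'z.
      by move: ee'; rewrite (bs_R_disjoint ez e'z) eqxx.
    by rewrite !indicE !mem_set.
  rewrite indicE memNset// mul0r big1// => e /eqP src_e.
  by rewrite indicE memNset ?mul0r// => /bs_R_sub_D; rewrite src_e.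
Qed.

End Operators.
End BranchingSystem.

(** * Comparison of the two representations *)

Lemma bs_D_ket (R : realType) (a b : R) (g : markov_map a b) (x : R)
    (i : vertex (markov_graph g)) (y : R) : backward_orbit g x y ->
  (fun z => \1_(bs_D x i) z * (\1_[set y] : R -> R[i]) z) =
  (\1_(piece i) y : R[i]) *: (\1_[set y] : R -> R[i]).
Proof.
move=> Xy; apply/funext => z.
rewrite [RHS](_ : _ = \1_(piece i) y * \1_[set y] z)//.
have [->|zy] := eqVneq z y; last first.
  by rewrite [\1_[set y] z]indicE memNset ?mulr0//=; apply/eqP.
congr (_ * _); rewrite !indicE; have [iy|niy] := pselect (piece i y).
  by rewrite !mem_set.
by rewrite !memNset// => -[].
Qed.

Theorem theorem4p3 (R : realType) (a b : R) (g : markov_map a b)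
    (minimal_g : minimal_partition g)
    (escape_g : escape_set g !=set0)
    (x : R) (escape_x : escape_set g x)
    (V : {set vertex (markov_graph g)})
    (escape_V : forall i : vertex (markov_graph g), i \in V ->
       escape_matrix (inl i) (esc_symbol g x) = 0%N)
    (A : cstarAlgType R)
    (s : edge (markov_graph g) -> A) (p : vertex (markov_graph g) -> A)
    (universal_A : is_relative_graph_algebra V s p) :
  let X := backward_orbit g x in
  let Y := gorbit g x in
  [/\ X = Y,
      exists nu : A -> L2 Y -> L2 Y, is_nu s p nu,
      exists pi : A -> L2 X -> L2 X, is_pi s p pi &
      exists U : L2 X -> L2 Y,
        [/\ is_L2_unitary U,
            forall (y : X) (y' : Y), val y = val y' -> U (ket y) = ket y' &
            forall (nu : A -> L2 Y -> L2 Y) (pi : A -> L2 X -> L2 X),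
              is_nu s p nu -> is_pi s p pi ->
              forall (c : A) (f : L2 X), U (pi c f) = nu c (U f)]].
Proof.
move=> X Y.
have XY : X = Y by exact: backward_orbit_gorbit.
have [t [q [tq tE qE]]] := bs_operators escape_x escape_V.
(* the existence part of the universal property *)
have [F [[FM Fs Fp] _]] := universal_A.2 _ _ _ tq.
pose pi0 c (f : L2 X) := F c f.
have pi0P : is_pi s p pi0.
  split; first exact: morphism_representation FM.
    by move=> e f; rewrite /pi0 Fs.
  by move=> i f; rewrite /pi0 Fp.
have XofY (y : Y) : X (val y) by rewrite XY; exact: set_mem (valP y).
split=> //.
- exists (fun c h => castL2 XY (pi0 c (castL2 (esym XY) h))); split.
  + exact: castL2_representation (pi_representation pi0P).
  + move=> e y; rewrite castL2E (pi_edge pi0P) castL2E.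
    exact: bs_ket (XofY y).
  + move=> i y; apply: val_inj; rewrite /= castL2E (pi_vertex pi0P) castL2E.
    exact: bs_D_ket (XofY y).
- by exists pi0.
- exists (castL2 XY); split; first exact: castL2_unitary.
    by move=> y y'; exact: castL2_ket.
  move=> nu pi nuP piP c f.
  (* [nu], carried over to [L2 X], agrees with [pi] on the basis *)
  pose rho d h := castL2 (esym XY) (nu d (castL2 (esym (esym XY)) h)).
  have rhoP : is_representation rho.
    exact: castL2_representation (nu_representation nuP).
  have ketE (y : X) : exists2 y' : Y, castL2 (esym (esym XY)) (ket y) = ket y' &
      val y' = val y.
    have Yy : Y (val y) by rewrite -XY; exact: set_mem (valP y).
    by exists (SigSub (mem_set Yy)) => //; exact: castL2_ket.
  rewrite (representation_unique universal_A (pi_representation piP) rhoP).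
  + by rewrite /rho castL2K (_ : esym (esym XY) = XY)//; exact: Prop_irrelevance.
  + move=> e y; apply: val_inj; rewrite /= /rho castL2E (pi_edge piP).
    have [y' -> yy'] := ketE y; rewrite (nu_edge nuP) yy'.
    by apply: bs_ket; exact: set_mem (valP y).
  + move=> i y; apply: val_inj; rewrite /= /rho castL2E (pi_vertex piP).
    have [y' -> yy'] := ketE y; rewrite (nu_vertex nuP) yy'.
    by rewrite /= yy'; apply: bs_D_ket; exact: set_mem (valP y).
Qed.
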